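(* Let $n\geq 1$ be an integer and let $\mu_2$ be the measure on $\mathbb{R}^2$ given in Cartesian coordinates $(x,y)$ by $\mu_2=C(n)|y|^{n-1}e^{-(x^2+y^2)/2}\,dx\,dy$, with $C(n)=\left(\int_{-\pi/2}^{\pi/2}\cos(t)^{n-1}dt\right)^{-1}$. Let $K_1,K_2$ be two centrally-symmetric convex bodies in $\mathbb{R}^2$. Then there exist two strips $S_1,S_2$ in $\mathbb{R}^2$ such that $$\frac{\mu_2(K_1\cap K_2)}{\mu_2(K_1)\mu_2(K_2)}\geq\frac{\mu_2(S_1\cap S_2)}{\mu_2(S_1)\mu_2(S_2)}.$$
   Context: A strip in $\mathbb{R}^2$ is a set of the form $S=\{z\in\mathbb{R}^2:|z\cdot u|<h\}$ with $u\in\mathbb{S}^1$ and $h>0$. *)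

(* Defs.v *)
From HB Require Import structures.
From mathcomp Require Import all_boot all_order all_algebra.
From mathcomp Require Import all_classical all_reals all_analysis.
Set Implicit Arguments. Unset Strict Implicit. Unset Printing Implicit Defensive.
Import Order.TTheory GRing.Theory Num.Theory.
Import numFieldNormedType.Exports.
Local Open Scope classical_set_scope.
Local Open Scope ring_scope.

Definition leb2 (R : realType) :=
  ((@lebesgue_measure R) \x (@lebesgue_measure R))%E.

Definition Cn (R : realType) (n : nat) : R :=
  (fine (\int[@lebesgue_measure R]_(t in `[- (pi / 2), pi / 2]) ((cos t) ^+ n.-1)%:E))^-1.

Definition dens2 (R : realType) (n : nat) (z : R * R) : R :=
  Cn R n * `|z.2| ^+ n.-1 * expR (- (z.1 ^+ 2 + z.2 ^+ 2) / 2).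

Definition mu2 (R : realType) (n : nat) (A : set (R * R)) : \bar R :=
  (\int[@leb2 R]_(z in A) (dens2 n z)%:E)%E.

Definition convex2 (R : realType) (K : set (R * R)) : Prop :=
  forall a b, K a -> K b -> forall t : R, 0 <= t <= 1 ->
    K (t * a.1 + (1 - t) * b.1, t * a.2 + (1 - t) * b.2).

Definition convex_body2 (R : realType) (K : set (R * R)) : Prop :=
  compact K /\ convex2 K /\ (K°) !=set0.

Definition centrally_symmetric2 (R : realType) (K : set (R * R)) : Prop :=
  forall z, K z -> K (- z.1, - z.2).

Definition is_strip (R : realType) (S : set (R * R)) : Prop :=
  exists (u : R * R) (h : R), u.1 ^+ 2 + u.2 ^+ 2 = 1 /\ 0 < h /\
    S = [set z | `|z.1 * u.1 + z.2 * u.2| < h].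

Definition ratio2 (R : realType) (n : nat) (A B : set (R * R)) : R :=
  fine (mu2 n (A `&` B)) / (fine (mu2 n A) * fine (mu2 n B)).

(* Main.v *)
(* Up to the factor C(n)^-1 the ratio only involves nu = |y|^(n-1) e^(-(x^2+y^2)/2).

   If n >= 2, the density vanishes on the line y = 0, and two transversal strips
   of width h -> 0 have arbitrarily small ratio, while that of K1, K2 is positive.

   If n = 1, nu is Gaussian; orthogonal strips are independent, and the Gaussian
   correlation inequality g(A) g(B) <= g(A /\ B) is needed in the plane. For a
   fixed finite set of slopes, let q be the best constant such that
   q g(A) g(B) <= g(A /\ B) for all symmetric polygons A, B with these slopes.
   Put A_v = {u | (u + v)/sqrt 2 and (u - v)/sqrt 2 lie in A}, again such a
   polygon. Invariance of the doubled measure under the rotation by pi/4 gives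
   g(A)^2 = \int g(A_v) dg(v), and the inequality for the pairs (A_v, B_v)
   and (A_u, B_w) gives q^2 (g(A) g(B))^2 <= g(A /\ B)^2. For small v the
   polygons A_v and B_v have widths at least 6/5 of those of A and B, so a constant
   larger than q valid for wide polygons propagates to narrower ones. A polygon with
   one very small width is compared directly with a strip, and a strip is
   positively correlated with every symmetric convex set; if two widths are
   small, the two smallest widths of a polygon give its mass up to a constant.
   Hence q = 1; general convex bodies are intersections of strips with rational
   slopes. *)

From HB Require Import structures.
Require Import Defs.
From mathcomp Require Import all_boot all_order all_algebra.
From mathcomp Require Import all_classical all_reals all_analysis.
From mathcomp Require Import measurable_realfun ring lra.
Set Implicit Arguments. Unset Strict Implicit. Unset Printing Implicit Defensive.
Import Order.TTheory GRing.Theory Num.Theory.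
Import numFieldNormedType.Exports.
Local Open Scope classical_set_scope.
Local Open Scope ring_scope.

(** * Lebesgue measure under translations and reflections of the line *)

Section LebesgueAffine.
Context {R : realType}.
Notation lam := (@lebesgue_measure R).

(** Doubling with a single constant [q] only returns [q ^+ 2] for the squares. Progress comes from a
    set of [v] of positive mass [b] on which a larger constant [q'] is already known: [q ^+ 2] then
    becomes [q ^+ 2 + (q' - q) * b]. This set consists of the [v] that are small compared with the
    current width [r], so the gain fades as [r] tends to 0 and infinitely many steps might end at
    [q] again. The descent therefore stops after finitely many steps at a positive width, and thin
    polygons need a separate bound that is uniform in all widths. Fixing finitely many slopes makes
    this possible: the geometric constants depend on the slopes only, and passing to [halves]
    changes nothing but the widths, because two numbers [x + y] and [x - y] are bounded by [k] in
    absolute value exactly when [|x| + |y| <= k]. The correlation that can be had directly is that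
    of a strip with a symmetric convex set: the sections parallel to the strip lose mass away from
    its centre line, so a Chebyshev argument applies. Thin polygons are reduced to this case. *)

Lemma lebesgue_affine (s a : R) (A : set (measurableTypeR R)) : `|s| = 1 ->
  measurable A -> lam ((fun y : R => s * y + a) @^-1` A) = lam A.
Proof.
move=> s1 mA.
have mf : measurable_fun [set: measurableTypeR R]
    (fun y : measurableTypeR R => s * y + a : measurableTypeR R).
  by apply: measurable_funD => //; apply: measurable_funM.
pose f : {mfun measurableTypeR R >-> measurableTypeR R} :=
  HB.pack (fun y : measurableTypeR R => s * y + a : measurableTypeR R)
    (isMeasurableFun.Build _ _ _ _ _ mf).
rewrite -[LHS]/(pushforward lam f A); apply/esym/lebesgue_measure_unique => //.
move=> _ [[b c]] _ <-; rewrite /pushforward /f /=.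
have [->|->] : s = 1 \/ s = -1.
  by move/eqP: s1; rewrite eqr_norml ler01 andbT => /orP[]/eqP; [left|right].
- rewrite [X in _ = lam X](_ : _ = `]b - a, c - a]%classic).
    rewrite !lebesgue_measure_itv/= !lte_fin ltrD2r.
    by case: ifP => // _; rewrite -!EFinD; congr (_%:E); ring.
  by apply/seteqP; split => x /=; rewrite !in_itv/= mul1r; lra.
- rewrite [X in _ = lam X](_ : _ = `[a - c, a - b[%classic).
    rewrite !lebesgue_measure_itv/= !lte_fin ltrD2l ltrN2.
    by case: ifP => // _; rewrite -!EFinD; congr (_%:E); ring.
  by apply/seteqP; split => x /=; rewrite !in_itv/= mulN1r; lra.
Qed.

End LebesgueAffine.

(** * Rotation invariance of planar Lebesgue measure *)

Section PlaneRotation.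
Context {R : realType}.
Notation lam := (@lebesgue_measure R).
Notation line := (measurableTypeR R).
Notation plane := (measurableTypeR R * measurableTypeR R)%type.

Lemma leb2_transpose (X : set plane) : measurable X ->
  leb2 X = (\int[lam]_y lam (ysection X y))%E.
Proof.
move=> mX; apply: (product_measure_unique (m' := (lam \x^ lam)%E)) mX => A B.
exact: product_measure2E.
Qed.

Lemma measurable_linear (a b : R) :
  measurable_fun [set: plane] (fun z : plane => a * z.1 + b * z.2 : line).
Proof.
by apply: measurable_funD; apply: measurable_funM.
Qed.

Lemma measurable_linear2 (a b c d : R) : measurable_fun [set: plane]
  (fun z : plane => (a * z.1 + b * z.2, c * z.1 + d * z.2) : plane).
Proof. by apply: measurable_fun_pair; exact: measurable_linear. Qed.

Lemma measurable_preimageT d d' (T : measurableType d) (T' : measurableType d')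
    (f : T -> T') (X : set T') :
  measurable_fun [set: T] f -> measurable X -> measurable (f @^-1` X).
Proof. by move=> mf mX; rewrite -[_ @^-1` _]setTI; exact: mf. Qed.

Definition rot (c s : R) (z : plane) : plane :=
  (c * z.1 + s * z.2, - s * z.1 + c * z.2).

Lemma leb2_shear1 (a : R) (X : set plane) : measurable X ->
  leb2 ((fun z : plane => (1 * z.1 + a * z.2, 0 * z.1 + 1 * z.2)) @^-1` X)
    = leb2 X.
Proof.
move=> mX.
rewrite !leb2_transpose//; last exact: measurable_preimageT (measurable_linear2 _ _ _ _) mX.
apply: eq_integral => y _.
rewrite -[RHS](@lebesgue_affine _ 1 (a * y)) ?normr1//; last first.
  exact: measurable_ysection.
by congr lam; rewrite !ysectionE; apply/seteqP; split => x /=;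
  rewrite mul0r add0r !mul1r.
Qed.

Lemma leb2_shear2 (a : R) (X : set plane) : measurable X ->
  leb2 ((fun z : plane => (1 * z.1 + 0 * z.2, a * z.1 + 1 * z.2)) @^-1` X)
    = leb2 X.
Proof.
move=> mX; apply: eq_integral => x _ /=.
rewrite -[RHS](@lebesgue_affine _ 1 (a * x)) ?normr1//; last first.
  exact: measurable_xsection.
by congr lam; rewrite !xsectionE; apply/seteqP; split => y /=;
  rewrite mul0r addr0 !mul1r addrC.
Qed.

Lemma measurable_rot c s : measurable_fun [set: plane] (rot c s).
Proof. exact: measurable_linear2. Qed.

(* A rotation is a product of three shears: with t = tan(theta/2) = s/(1+c),
   shear by t along x, by -s along y, and by t along x again. *)
Lemma leb2_rot (c s : R) (X : set plane) : 0 < c -> c ^+ 2 + s ^+ 2 = 1 ->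
  measurable X -> leb2 (rot c s @^-1` X) = leb2 X.
Proof.
move=> c0 cs1 mX; set t := s / (1 + c).
have c10 : 1 + c != 0 by rewrite gt_eqF// addr_gt0.
have st : s * t = 1 - c.
  have s2 : s * s = (1 - c) * (1 + c) by nra.
  by rewrite /t mulrA s2 mulfK.
have tct : t + t * c = s by rewrite -[X in X + _]mulr1 -mulrDr /t mulfVK.
have mX1 := measurable_preimageT (measurable_linear2 1 t 0 1) mX.
have mX2 := measurable_preimageT (measurable_linear2 1 0 (- s) 1) mX1.
rewrite -[RHS](leb2_shear1 t mX) -[RHS](leb2_shear2 (- s) mX1).
rewrite -[RHS](leb2_shear1 t mX2).
congr leb2; apply/funext => -[x y] /=; congr X; rewrite /rot /=.
have e1 : x * (s * t) = x * (1 - c) by rewrite st.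
have e2 : y * (s * t) = y * (1 - c) by rewrite st.
have e3 : y * (t + t * c) = y * s by rewrite tct.
have e4 : t * (y * (s * t)) = t * (y * (1 - c)) by rewrite st.
by congr (_, _); lra.
Qed.

End PlaneRotation.

(** * The Gaussian measure of the plane: density and rotation invariance *)

Section GaussianPlane.
Context {R : realType}.
Notation lam := (@lebesgue_measure R).
Notation line := (measurableTypeR R).
Notation plane := (measurableTypeR R * measurableTypeR R)%type.

Definition gauss1 : probability line R := normal_prob (0 : R) (1 : R).
Definition gauss2 : probability plane R := (gauss1 \x gauss1)%E.

Definition gpdf (x : R) : R := normal_pdf 0 1 x.

Lemma gpdfE x : gpdf x = (Num.sqrt (pi *+ 2))^-1 * expR (- x ^+ 2 / 2).
Proof.
by rewrite /gpdf normal_pdfE ?oner_neq0// /normal_peak /normal_fun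
  expr1n mul1r subr0.
Qed.

Lemma gpdf_ge0 x : 0 <= gpdf x. Proof. exact: normal_pdf_ge0. Qed.

Lemma measurable_gpdf : measurable_fun [set: line] (gpdf : line -> line).
Proof. exact: measurable_normal_pdf. Qed.

Lemma gauss1E (A : set line) : gauss1 A = (\int[lam]_(x in A) (gpdf x)%:E)%E.
Proof. by []. Qed.

(** Since [pi >= 2], the square root of [pi *+ 2] is at least 2. With this bound the mass of
    [strip t a] is at most [a], with no further constant. *)
Lemma gpdf_leM (x : R) : gpdf x <= 2^-1.
Proof.
apply: (le_trans (normal_pdf_ub 0 x (oner_neq0 R))).
have pi0 : 0 < pi *+ 2 :> R by rewrite mulrn_wgt0 ?pi_gt0.
rewrite /normal_peak expr1n mul1r lef_pV2 ?posrE ?sqrtr_gt0//.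
rewrite -[leLHS]ger0_norm// -sqrtr_sqr ler_sqrt; last first.
  by rewrite mulrn_wge0// pi_ge0.
by rewrite mulr2n; have := pi_ge2 R; lra.
Qed.

Lemma gpdf_homo (x y : R) : `|x| <= `|y| -> gpdf y <= gpdf x.
Proof.
move=> xy; rewrite !gpdfE ler_wpM2l// ler_expR !mulNr lerN2 ler_pM2r//.
by rewrite -(real_normK (num_real x)) -(real_normK (num_real y)) lerXn2r ?nnegrE.
Qed.

Lemma gauss1_le_lam (A : set line) : measurable A ->
  (gauss1 A <= 2^-1%:E * lam A)%E.
Proof.
move=> mA; rewrite gauss1E -integral_cst//; apply: ge0_le_integral => //.
- by move=> x _; rewrite lee_fin gpdf_ge0.
- by apply/measurable_EFinP/measurable_funTS; exact: measurable_gpdf.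
- by move=> x _; rewrite lee_fin gpdf_leM.
Qed.

Lemma gauss1_ge_lam (A : set line) (k : R) : measurable A -> 0 <= k ->
  (forall x, A x -> k <= gpdf x) -> (k%:E * lam A <= gauss1 A)%E.
Proof.
move=> mA k0 kA; rewrite gauss1E -integral_cst//; apply: ge0_le_integral => //.
by apply/measurable_EFinP/measurable_funTS; exact: measurable_gpdf.
Qed.

Definition gpdf2 (z : plane) : R := gpdf z.1 * gpdf z.2.

Lemma gpdf2E z :
  gpdf2 z = (pi *+ 2)^-1 * expR (- (z.1 ^+ 2 + z.2 ^+ 2) / 2).
Proof.
rewrite /gpdf2 !gpdfE mulrACA -expRD -invfM -expr2 sqr_sqrtr; last first.
  by rewrite mulrn_wge0// pi_ge0.
by congr (_ * expR _); lra.
Qed.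

Lemma measurable_gpdf2 : measurable_fun [set: plane] (EFin \o gpdf2).
Proof.
apply/measurable_EFinP; apply: measurable_funM.
  by apply: (measurableT_comp measurable_gpdf).
by apply: (measurableT_comp measurable_gpdf).
Qed.

Let gpdf2_ge0 z : (0 <= (gpdf2 z)%:E)%E.
Proof. by rewrite lee_fin mulr_ge0// gpdf_ge0. Qed.

Let nu (X : set plane) : \bar R := (\int[@leb2 R]_(z in X) (gpdf2 z)%:E)%E.

Let nu0 : nu set0 = 0%E. Proof. exact: integral_set0. Qed.

Let nu_ge0 X : (0 <= nu X)%E. Proof. by apply: integral_ge0 => z _. Qed.

Let nu_sigma_additive : semi_sigma_additive nu.
Proof.
move=> F mF tF mUF; rewrite /nu ge0_integral_bigcup//.
- by apply: is_cvg_ereal_nneg_natsum_cond => n _ _; exact: integral_ge0.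
- by apply: measurable_funTS; exact: measurable_gpdf2.
Qed.

HB.instance Definition _ :=
  isMeasure.Build _ _ _ nu nu0 nu_ge0 nu_sigma_additive.

(** [nu] was made a measure so that uniqueness of the product measure applies: it suffices to
    compare on rectangles, where Tonelli separates the two factors of the density. *)
Lemma gauss2E (X : set plane) : measurable X ->
  gauss2 X = (\int[@leb2 R]_(z in X) (gpdf2 z)%:E)%E.
Proof.
move=> mX; apply: (product_measure_unique (m' := nu)) mX => A B mA mB.
rewrite /= /nu integral_mkcond.
rewrite (eq_integral (fun z : plane => ((gpdf z.1)%:E * (\1_A z.1)%:E) *
    ((gpdf z.2)%:E * (\1_B z.2)%:E))%E); last first.
  move=> [x y] _; rewrite patchE/= !indicE -!EFinM.
  have [xyAB|xyAB] := boolP ((x, y) \in A `*` B).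
    by move: xyAB; rewrite inE => -[/= /mem_set -> /mem_set ->]; rewrite !mulr1.
  have [xA|xA] := boolP (x \in A); have [yB|yB] := boolP (y \in B);
    rewrite ?(mulr0,mul0r)//.
  by case/negP: xyAB; rewrite inE; split => /=; exact/set_mem.
have mi (C : set line) : measurable C ->
    measurable_fun [set: line] (fun x : line => (gpdf x)%:E * (\1_C x)%:E)%E.
  move=> mC; apply: emeasurable_funM; apply/measurable_EFinP.
    exact: measurable_gpdf.
  exact: measurable_indic.
have pi0 (C : set line) x : (0 <= (gpdf x)%:E * (\1_C x)%:E)%E.
  by rewrite mule_ge0// lee_fin// gpdf_ge0.
have gE (C : set line) : measurable C ->
    (\int[lam]_x ((gpdf x)%:E * (\1_C x)%:E) = gauss1 C)%E.
  move=> mC; rewrite gauss1E [RHS]integral_mkcond; apply: eq_integral => x _.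
  by rewrite patchE indicE; case: ifP => _; rewrite ?mule1 ?mule0.
rewrite /leb2 fubini_tonelli1//; first last.
- by move=> z; rewrite mule_ge0.
- apply: emeasurable_funM.
    by apply: (measurableT_comp (mi _ mA)).
  by apply: (measurableT_comp (mi _ mB)).
rewrite /fubini_F/=.
transitivity (\int[lam]_x ((gpdf x)%:E * (\1_A x)%:E * gauss1 B))%E.
  by apply: eq_integral => x _; rewrite ge0_integralZl ?gE//; exact: mi.
by rewrite ge0_integralZr ?gE//; exact: mi.
Qed.

Lemma gpdf2_rot (c s : R) (z : plane) : c ^+ 2 + s ^+ 2 = 1 ->
  gpdf2 (rot c s z) = gpdf2 z.
Proof.
move=> cs1; rewrite !gpdf2E.
suff -> : (rot c s z).1 ^+ 2 + (rot c s z).2 ^+ 2 = z.1 ^+ 2 + z.2 ^+ 2 by [].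
rewrite -[RHS]mul1r -cs1; case: z => x y; rewrite /rot/=.
set u : R := x; set v : R := y; ring.
Qed.

Lemma gauss2_rot (c s : R) (X : set plane) : 0 < c -> c ^+ 2 + s ^+ 2 = 1 ->
  measurable X -> gauss2 (rot c s @^-1` X) = gauss2 X.
Proof.
move=> c0 cs1 mX.
have mr := measurable_rot c s.
have mX' := measurable_preimageT mr mX.
rewrite (gauss2E mX) (gauss2E mX').
transitivity (\int[pushforward (@leb2 R) (rot c s)]_(z in X) (gpdf2 z)%:E)%E.
  have mg := measurable_funTS measurable_gpdf2 : measurable_fun X _.
  rewrite (ge0_integral_pushforward mr _ mX mg); last first.
    by move=> z _; exact: gpdf2_ge0.
  by apply: eq_integral => z _; congr (_%:E); exact/esym/gpdf2_rot.
by apply: eq_measure_integral => A mA _; exact: leb2_rot.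
Qed.

End GaussianPlane.

(** * Rearrangement of intervals for the Gaussian measure of the line *)

Section GaussianLine.
Context {R : realType}.
Notation lam := (@lebesgue_measure R).
Notation line := (measurableTypeR R).
Notation gauss1 := (@gauss1 R).
Notation gauss2 := (@gauss2 R).

Definition flip (p : R) (y : line) : line := -1 * y + p.

Lemma measurable_flip (p : R) : measurable_fun [set: line] (flip p).
Proof. by apply: measurable_funD => //; apply: measurable_funM. Qed.

Lemma gauss1_reflectE (p : R) (E : set line) : measurable E ->
  (gauss1 E = \int[lam]_(y in flip p @^-1` E)
                (gpdf (flip p y))%:E)%E.
Proof.
move=> mE.
have mf := measurable_flip p.
transitivity (\int[pushforward lam (flip p)]_(y in E)
   (gpdf y)%:E)%E.
  rewrite gauss1E; apply: eq_measure_integral => A mA _.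
  by rewrite -[LHS](@lebesgue_affine _ (-1) p)// normrN1.
rewrite ge0_integral_pushforward//.
  by apply: measurable_funTS; apply/measurable_EFinP; exact: measurable_gpdf.
by move=> y _; rewrite lee_fin gpdf_ge0.
Qed.

Lemma measurable_reflect (p : R) (E : set line) : measurable E ->
  measurable (flip p @^-1` E).
Proof.
exact: measurable_preimageT (measurable_flip p).
Qed.

Lemma gauss1_sym (E : set line) : measurable E ->
  gauss1 (flip 0 @^-1` E) = gauss1 E.
Proof.
move=> mE; rewrite (gauss1_reflectE 0 mE) gauss1E.
apply: eq_integral => y _; rewrite /flip addr0 mulN1r; congr (_%:E); apply/le_anti.
by rewrite !gpdf_homo ?normrN.
Qed.

(** [flip (p + p)] is the reflection at [p]. It brings points beyond [p] no farther from 0, where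
    the density is no smaller. *)
Lemma gauss1_reflect_le (p : R) (E : set line) : 0 <= p -> measurable E ->
  E `<=` [set y | p <= y] ->
  (gauss1 E <= gauss1 (flip (p + p) @^-1` E))%E.
Proof.
move=> p0 mE Ep; rewrite (gauss1_reflectE (p + p) mE) gauss1E.
have mE' := measurable_reflect (p + p) mE.
apply: ge0_le_integral => //.
- by move=> y _; rewrite lee_fin gpdf_ge0.
- apply: measurable_funTS; apply/measurable_EFinP.
  apply: measurableT_comp; first exact: measurable_gpdf.
  exact: measurable_flip.
- by apply: measurable_funTS; apply/measurable_EFinP; exact: measurable_gpdf.
- move=> y /Ep/= py; rewrite lee_fin gpdf_homo// ler_norml.
  by rewrite (ger0_norm (le_trans p0 py)); move: py; rewrite /flip; lra.
Qed.

Let seg (c w : R) : set line := `[c - w, c + w]%classic.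

Let measurable_seg c w : measurable (seg c w). Proof. exact: measurable_itv. Qed.

(** The common part of the two segments cancels. The rest of the farther one lies beyond the
    midpoint [(c + c') / 2], and reflection there maps it into the rest of the nearer one. *)
Lemma gauss1_recenter0 (w c c' : R) : 0 <= c' -> c' <= c ->
  (gauss1 (seg c w) <= gauss1 (seg c' w))%E.
Proof.
move=> c'0 c'c.
have mD : measurable (seg c w `\` seg c' w).
  by apply: measurableD; exact: measurable_seg.
rewrite (measureDI gauss1 (measurable_seg c w) (measurable_seg c' w)).
rewrite [leRHS](measureDI gauss1 (measurable_seg c' w) (measurable_seg c w)).
rewrite [seg c w `&` _]setIC leeD2r//.
have p0 : 0 <= (c + c') / 2 by lra.
apply: (le_trans (gauss1_reflect_le p0 mD _)).
  move=> y [] /=; rewrite /seg/= !in_itv/= => /andP[h1 h2] h3.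
  by rewrite leNgt; apply/negP => h4; apply: h3; lra.
rewrite le_measure ?inE//; first exact: measurable_reflect.
  by apply: measurableD; exact: measurable_seg.
move=> y [] /=; rewrite /seg/flip/= !in_itv/= => /andP[h1 h2] h3.
split; first by lra.
by move=> h; apply: h3; lra.
Qed.

Lemma gauss1_recenter (w c c' : R) : `|c'| <= `|c| ->
  (gauss1 (seg c w) <= gauss1 (seg c' w))%E.
Proof.
have segN d : gauss1 (seg (- d) w) = gauss1 (seg d w).
  rewrite -[RHS](gauss1_sym (measurable_seg d w)); congr (gauss1 _); apply/seteqP.
  by split => x /=; rewrite /seg/flip/= !in_itv/=; lra.
have segA d : gauss1 (seg `|d| w) = gauss1 (seg d w).
  by case: (ger0P d) => _; rewrite ?segN.
by move=> cc'; rewrite -segA -[leRHS]segA gauss1_recenter0.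
Qed.

Lemma gauss1_point (a : R) : gauss1 [set a] = 0%E.
Proof.
apply/eqP; rewrite eq_le measure_ge0 andbT.
apply: (le_trans (gauss1_le_lam (measurable_set1 a))).
by rewrite lebesgue_measure_set1 mule0.
Qed.

Lemma gauss1_itvcc_oo (a b : R) : (gauss1 `[a, b]%classic <= gauss1 `]a, b[%classic)%E.
Proof.
rewrite -[leRHS]adde0 -(gauss1_point a) -[leRHS]adde0 -(gauss1_point b).
have mab : measurable (`]a, b[%classic : set line) by exact: measurable_itv.
have m1 c : measurable ([set c] : set line) by exact: measurable_set1.
apply: (@le_trans _ _ (gauss1 (`]a, b[%classic `|` [set a] `|` [set b]))); last first.
  apply: (le_trans (measureU2 _ _ _)) => //; first exact: measurableU.
  by apply: leeD => //; exact: measureU2.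
rewrite le_measure ?inE//; first by do 2 apply: measurableU => //.
move=> x/=; rewrite !in_itv/= => /andP[].
rewrite le_eqVlt => /orP[/eqP->|xa]; first by left; right.
by rewrite le_eqVlt => /orP[/eqP->|xb]; [right|left; left; rewrite xa].
Qed.

(** The mixtures [(1 - b) y - b y'] fill an interval as long as [I] whose centre is [1 - b *+ 2]
    times that of [I], hence nearer to 0. As [I] may lack its endpoints, only the open interval is
    found inside [J]; endpoints carry no mass. *)
Lemma gauss1_mix_bounded (I J : set line) (b M : R) : is_interval I ->
  measurable I -> measurable J -> 0 <= b <= 1 -> (forall y, I y -> `|y| <= M) ->
  (forall y y', I y -> I y' -> J ((1 - b) * y - b * y')) ->
  (gauss1 I <= gauss1 J)%E.
Proof.
move=> iI mI mJ /andP[b0 b1] IM IJ.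
have [->|/set0P I0] := eqVneq I set0; first by rewrite measure0.
have hasI : has_sup I /\ has_inf I.
  by split; split=> //; [exists M|exists (- M)] => y /IM; rewrite ler_norml => /andP[].
case: hasI => supI infI.
pose l := inf I; pose r := sup I; pose c := (l + r) / 2; pose w := (r - l) / 2.
apply: (@le_trans _ _ (gauss1 (seg c w))).
  rewrite le_measure ?inE// => y Iy; rewrite /seg/= in_itv/=.
  have /(_ _ Iy) : ubound I r by exact: sup_upper_bound.
  have /(_ _ Iy) : lbound I l by apply: ge_inf; case: infI.
  by rewrite /c /w; lra.
apply: (@le_trans _ _ (gauss1 (seg ((1 - b *+ 2) * c) w))).
  apply: gauss1_recenter; rewrite normrM ler_piMl// ler_norml; lra.
apply: (le_trans (gauss1_itvcc_oo _ _)).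
rewrite le_measure ?inE// => y; rewrite /= in_itv/= => /andP[h1 h2].
have inI z : l < z -> z < r -> I z.
  move=> lz zr.
  have [x Ix xz] : exists2 x, I x & x < z by exact: inf_lt.
  have [x' Ix' zx'] : exists2 x, I x & z < x by exact: sup_gt.
  by apply: (iI x x') => //; rewrite !ltW.
pose t := y - (1 - b *+ 2) * c.
rewrite (_ : y = (1 - b) * (c + t) - b * (c - t)); last by rewrite /t; ring.
by apply: IJ; apply: inI; rewrite /t; move: h1 h2; rewrite /c /w; lra.
Qed.

Lemma gauss1_mix (I J : set line) (b : R) : is_interval I ->
  measurable I -> measurable J -> 0 <= b <= 1 ->
  (forall y y', I y -> I y' -> J ((1 - b) * y - b * y')) ->
  (gauss1 I <= gauss1 J)%E.
Proof.
move=> iI mI mJ b01 IJ.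
pose In (n : nat) : set line := I `&` seg 0 n%:R.
have InU : \bigcup_n In n = I.
  apply/seteqP; split => [y [n _ []]//|y Iy].
  exists (Num.truncn `|y|).+1 => //; split => //.
  rewrite /seg/= in_itv/= sub0r add0r -ler_norml ltW//.
  by rewrite truncnS_gt.
have mIn n : measurable (In n) by apply: measurableI.
have cvgI : gauss1 (In n) @[n --> \oo] --> gauss1 I.
  rewrite -[X in _ --> gauss1 X]InU.
  apply: nondecreasing_cvg_mu => //; first by rewrite InU.
  move=> m n mn; apply/subsetPset; apply: setIS => y; rewrite /seg/= !in_itv/=.
  by move: mn; rewrite -(ler_nat R) => mn; lra.
apply: (cvge_le _ cvgI); apply: nearW => n.
apply: (@gauss1_mix_bounded (In n) J b n%:R) => //.
- move=> x y [Ix sx] [Iy sy] z xzy; split; first exact: (iI x y).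
  by move: sx sy xzy; rewrite /seg/= !in_itv/=; lra.
- by move=> y [_]; rewrite /seg/= in_itv/= sub0r add0r -ler_norml.
- by move=> y y' [Iy _] [Iy' _]; exact: IJ.
Qed.

End GaussianLine.

(** * Probabilities as real numbers *)

HB.lock Definition prob d (T : measurableType d) (R : realType)
  (P : probability T R) (X : set T) : R := fine (P X).

Section RealProbability.
Context d (T : measurableType d) (R : realType) (P : probability T R).
Implicit Types X Y : set T.
Local Notation prob := (prob P).

Lemma probE X : measurable X -> P X = (prob X)%:E.
Proof. by move=> mX; rewrite prob.unlock fineK// fin_num_measure. Qed.

Lemma prob_nneg X : 0 <= prob X. Proof. by rewrite prob.unlock fine_ge0. Qed.

Lemma prob_leone X : measurable X -> prob X <= 1.
Proof. by move=> mX; rewrite -lee_fin -probE// probability_le1. Qed.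

Lemma prob_mono X Y : measurable X -> measurable Y -> X `<=` Y ->
  prob X <= prob Y.
Proof. by move=> mX mY XY; rewrite -lee_fin -!probE// le_measure ?inE. Qed.

Lemma prob_set0 : prob set0 = 0. Proof. by rewrite prob.unlock measure0. Qed.

Lemma prob_DI X Y : measurable X -> measurable Y ->
  prob X = prob (X `\` Y) + prob (X `&` Y).
Proof.
move=> mX mY; apply: EFin_inj; rewrite EFinD -!probE//.
- exact: measureDI.
- exact: measurableI.
- exact: measurableD.
Qed.

Lemma prob_U X Y : measurable X -> measurable Y ->
  prob (X `|` Y) <= prob X + prob Y.
Proof.
move=> mX mY; rewrite -lee_fin EFinD -!probE//; last exact: measurableU.
exact: measureU2.
Qed.

End RealProbability.

(** * Correlation of a vertical slab with a symmetric convex set *)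

Section Slabs.
Context {R : realType}.
Notation line := (measurableTypeR R).
Notation plane := (measurableTypeR R * measurableTypeR R)%type.
Notation gauss1 := (@gauss1 R).
Notation gauss2 := (@gauss2 R).

Notation g2 := (prob gauss2).

Lemma gauss2_xsection (X : set plane) :
  gauss2 X = (\int[gauss1]_x gauss1 (xsection X x))%E.
Proof. by []. Qed.

Lemma measurable_gauss1_xsection (X : set plane) : measurable X ->
  measurable_fun [set: line] (fun x => gauss1 (xsection X x)).
Proof. by move=> mX; exact: (measurable_fun_xsection gauss1 mX). Qed.

(** The section at [- x'] is the negative of the section at [x']. With [x = th * x'] and
    [b = (1 - th) / 2], the point [x] is [(1 - b) x' + b (- x')], so convexity puts the mixtures
    needed for [gauss1_mix] into the section at [x]. *)
Lemma gauss1_xsection_le (X : set plane) (x x' : R) : measurable X ->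
  convex2 X -> centrally_symmetric2 X -> `|x| <= `|x'| ->
  (gauss1 (xsection X x') <= gauss1 (xsection X x))%E.
Proof.
move=> mX cX sX xx'; pose th := x / x'.
(* For [x' = 0] the quotient [th] is 0 by convention, and [x] is 0 as well. *)
have thx : th * x' = x.
  have [x'0|x'0] := eqVneq x' 0; last by rewrite /th mulfVK.
  by move: xx'; rewrite x'0 normr0 normr_le0 mulr0 => /eqP.
have th1 : -1 <= th <= 1.
  rewrite -ler_norml /th normrM normfV.
  have [->|x'0] := eqVneq x' 0; first by rewrite normr0 invr0 mulr0.
  by rewrite ler_pdivrMr ?normr_gt0// mul1r.
apply: (@gauss1_mix _ _ _ ((1 - th) / 2)).
- move=> y y'; rewrite !xsectionE/= => Xy Xy' z /andP[yz zy'].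
  have [yy'|yy'] := eqVneq y y'.
    by rewrite (_ : z = y)//; apply: le_anti; rewrite yz andbT yy'.
  have yy'0 : 0 < y' - y by rewrite subr_gt0 lt_neqAle yy' (le_trans yz).
  have t01 : 0 <= (z - y) / (y' - y) <= 1.
    by apply/andP; split; [apply: divr_ge0|rewrite ler_pdivrMr//]; lra.
  have /= := cX _ _ Xy' Xy _ t01.
  rewrite (_ : _ * x' + _ = x'); last by ring.
  rewrite (_ : _ * y' + _ = z)//.
  set k := (z - y) / (y' - y).
  have : k * (y' - y) = z - y by rewrite /k mulfVK// gt_eqF.
  by lra.
- exact: measurable_xsection.
- exact: measurable_xsection.
- lra.
- move=> y y'; rewrite !xsectionE/= => Xy Xy'.
  have t01 : 0 <= (1 + th) / 2 <= 1 by lra.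
  have /= := cX _ _ Xy (sX _ Xy') _ t01.
  rewrite (_ : _ * x' + _ = x); last by rewrite -thx; field.
  by rewrite (_ : _ * y + _ = (1 - (1 - th) / 2) * y - (1 - th) / 2 * y')//; field.
Qed.

Definition slab (a : R) : set plane := [set z | `|z.1| <= a].

Lemma slabX a : slab a = (`[- a, a]%classic : set line) `*` [set: line].
Proof.
apply/seteqP; split => z /=; rewrite /slab/= in_itv/= ler_norml => //.
by case.
Qed.

Lemma measurable_slab a : measurable (slab a).
Proof. by rewrite slabX; apply: measurableX => //; exact: measurable_itv. Qed.

Lemma gauss2_slab a : gauss2 (slab a) = gauss1 `[- a, a]%classic.
Proof.
have mI : measurable (`[- a, a]%classic : set line) by exact: measurable_itv.
rewrite slabX; apply: (etrans (product_measure1E gauss1 gauss1 mI measurableT)).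
by rewrite [X in (_ * X)%E](probability_setT gauss1) mule1.
Qed.

Lemma chebyshev_arith (p i o k : R) : 0 <= p <= 1 -> k * p <= i ->
  o <= k * (1 - p) -> p * (o + i) <= i.
Proof.
move=> /andP[p0 p1] ki ok.
have h6 : p * o <= p * (k * (1 - p)) by apply: ler_wpM2l.
have h7 : (1 - p) * (k * p) <= (1 - p) * i by apply: ler_wpM2l => //; lra.
lra.
Qed.

(** Chebyshev's argument: the section mass [K] at the edge [x = a] is a lower bound for the sections
    inside the slab and an upper bound for those outside. The average over the slab is thus at least
    the average over its complement. *)
Lemma g2_slab_correlation (X : set plane) (a : R) : 0 <= a -> measurable X ->
  convex2 X -> centrally_symmetric2 X ->
  g2 (slab a) * g2 X <= g2 (slab a `&` X).
Proof.
move=> a0 mX cX sX.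
have mS := measurable_slab a.
pose I : set line := `[- a, a]%classic.
have mI : measurable I by exact: measurable_itv.
have mSX : measurable (X `&` slab a) by exact: measurableI.
have mDX : measurable (X `\` slab a) by exact: measurableD.
pose K := gauss1 (xsection X a).
have KE : K = (fine K)%:E by rewrite fineK//; apply: fin_num_measure; exact: measurable_xsection.
have K0 : 0 <= fine K := fine_ge0 (measure_ge0 _ _).
have IE : gauss1 I = (g2 (slab a))%:E by rewrite -(probE gauss2 mS) gauss2_slab.
have intK (C : set line) : measurable C ->
    (\int[gauss1]_x ((fine K)%:E * (\1_C x)%:E) =
      (fine K)%:E * gauss1 C)%E.
  move=> mC; rewrite ge0_integralZl//; last first.
    by apply/measurable_EFinP; exact: measurable_indic.
  by rewrite integral_indic// setIT.
have mK (C : set line) : measurable C ->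
    measurable_fun [set: line] (fun x => (fine K)%:E * (\1_C x)%:E)%E.
  move=> mC; apply: emeasurable_funM => //.
  by apply/measurable_EFinP; exact: measurable_indic.
have K1 (C : set line) x : (0 <= (fine K)%:E * (\1_C x)%:E)%E.
  by rewrite mule_ge0// lee_fin.
have inner : fine K * g2 (slab a) <= g2 (X `&` slab a).
  suff : ((fine K)%:E * gauss1 I <= gauss2 (X `&` slab a))%E.
    by rewrite IE (probE gauss2 mSX) -EFinM lee_fin.
  rewrite gauss2_xsection -(intK _ mI).
  apply: ge0_le_integral => //; first exact: mK.
    exact: measurable_gauss1_xsection.
  move=> x _; rewrite indicE; have [xI|] := boolP (x \in I); last first.
    by rewrite mule0.
  move: xI; rewrite inE /I/= in_itv/= -ler_norml mule1 -KE => xa.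
  rewrite (_ : xsection _ _ = xsection X x).
    by apply: gauss1_xsection_le => //; rewrite (ger0_norm a0).
  by rewrite !xsectionE; apply/seteqP; split => y /=; [case|].
have outer : g2 (X `\` slab a) <= fine K * (1 - g2 (slab a)).
  have mCI : measurable (~` I) by exact: measurableC.
  suff : (gauss2 (X `\` slab a) <= (fine K)%:E * gauss1 (~` I))%E.
    by rewrite probability_setC// IE (probE gauss2 mDX) -EFinB -EFinM lee_fin.
  rewrite gauss2_xsection -(intK _ mCI).
  apply: ge0_le_integral => //.
  - exact: measurable_gauss1_xsection.
  - exact: mK.
  - move=> x _; rewrite indicE; have [xI|] := boolP (x \in ~` I); last first.
      rewrite notin_setE => /contrapT; rewrite /I/= in_itv/= -ler_norml => xa.
      rewrite mule0 (_ : xsection _ _ = set0) ?measure0//.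
      by rewrite xsectionE; apply/seteqP; split => y //= -[_]; exact.
    move: xI; rewrite inE /I/= in_itv/= -ler_norml mule1 -KE => /negP.
    rewrite -ltNge => xa; apply: (@le_trans _ _ (gauss1 (xsection X x))).
      rewrite le_measure ?inE//; [exact: measurable_xsection..|].
      by rewrite !xsectionE => y [].
    by apply: gauss1_xsection_le => //; rewrite (ger0_norm a0) ltW.
have p1 := prob_leone gauss2 mS; have p0 := prob_nneg gauss2 (slab a).
rewrite setIC (prob_DI gauss2 mX mS).
by apply: chebyshev_arith inner outer; rewrite p0 p1.
Qed.

End Slabs.

(** * Strips of any slope: bounds on their mass, and correlation *)

Section Strips.
Context {R : realType}.
Notation line := (measurableTypeR R).
Notation plane := (measurableTypeR R * measurableTypeR R)%type.
Notation gauss1 := (@gauss1 R).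
Notation gauss2 := (@gauss2 R).
Notation g1 := (prob gauss1).
Notation g2 := (prob gauss2).

Let seg (a b : R) : set line := `[a, b]%classic.

Let measurable_seg a b : measurable (seg a b). Proof. exact: measurable_itv. Qed.

Lemma g1_seg_le (a b : R) : a <= b -> g1 (seg a b) <= (b - a) / 2.
Proof.
move=> ab; rewrite -lee_fin -(probE gauss1 (measurable_seg a b)).
apply: (le_trans (gauss1_le_lam (measurable_seg a b))).
rewrite lebesgue_measure_itv/= lte_fin; case: ifP => _.
  by rewrite -EFinD -EFinM lee_fin mulrC.
by rewrite mule0 lee_fin; lra.
Qed.

Lemma g1_seg_ge (b : R) : 0 <= b <= 1 -> gpdf 1 * b <= g1 (seg (- b) b).
Proof.
move=> /andP[b0 b1]; rewrite -lee_fin -(probE gauss1 (measurable_seg _ _)).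
apply: le_trans (gauss1_ge_lam (measurable_seg _ _) (gpdf_ge0 1) _); last first.
  move=> x; rewrite /seg/= in_itv/= => xb; apply: gpdf_homo.
  by rewrite normr1 ler_norml; lra.
rewrite lebesgue_measure_itv/= lte_fin; case: ifP => [_|].
  by rewrite -EFinD -EFinM lee_fin ler_wpM2l ?gpdf_ge0//; lra.
move=> /negbT; rewrite -leNgt => bb; rewrite mule0 lee_fin.
by rewrite (_ : b = 0) ?mulr0//; lra.
Qed.

Lemma g2_slab (a : R) : g2 (slab a) = g1 (seg (- a) a).
Proof.
by apply: EFin_inj; rewrite -(probE _ (measurable_slab a)) gauss2_slab
  (probE gauss1 (measurable_seg _ _)).
Qed.

(** The normal vector [(1, t)] is not normalised: the true half-width is [a / slope_norm t]. In this
    form the width depends linearly on the point, and only the normal [(0, 1)] is left out. *)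
Definition strip (t a : R) : set plane := [set z | `|z.1 + t * z.2| <= a].

Definition slope_norm (t : R) := Num.sqrt (1 + t ^+ 2).

Lemma slope_norm_ge1 t : 1 <= slope_norm t.
Proof. by rewrite -[leLHS]sqrtr1; apply: ler_wsqrtr; rewrite lerDl sqr_ge0. Qed.

Let slope_norm_gt0 t : 0 < slope_norm t.
Proof. exact: lt_le_trans (slope_norm_ge1 t). Qed.

Let co t := (slope_norm t)^-1.
Let si t := t * co t.

Let co_gt0 t : 0 < co t. Proof. by rewrite invr_gt0. Qed.

Let co_si t : co t ^+ 2 + si t ^+ 2 = 1.
Proof.
rewrite /co /si exprMn -[X in X + _]mul1r !exprVn -mulrDl sqr_sqrtr.
  by rewrite divff// gt_eqF// ltr_pwDl// sqr_ge0.
by rewrite addr_ge0 ?sqr_ge0.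
Qed.

Lemma strip_rot t a : strip t a = rot (co t) (si t) @^-1` slab (a * co t).
Proof.
apply/funext => z; rewrite /strip /slab /rot /=; apply/propext.
rewrite (_ : co t * z.1 + si t * z.2 = (z.1 + t * z.2) * co t).
  by rewrite normrM (gtr0_norm (co_gt0 t)) ler_pM2r.
by rewrite /si; move: (z.1) (z.2) (co t) => /= x y k; set u : R := x; set v : R := y; ring.
Qed.

Let unrot c s (X : set plane) : c ^+ 2 + s ^+ 2 = 1 ->
  rot c s @^-1` (rot c (- s) @^-1` X) = X.
Proof.
move=> cs; apply/funext => -[x y] /=; congr X; rewrite /rot/=.
have ex : x * (c ^+ 2 + s ^+ 2) = x by rewrite cs mulr1.
have ey : y * (c ^+ 2 + s ^+ 2) = y by rewrite cs mulr1.
by congr (_, _); [rewrite -[RHS]ex|rewrite -[RHS]ey];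
  set u : R := x; set v : R := y; ring.
Qed.

Lemma g2_rot t (X : set plane) : measurable X ->
  g2 (rot (co t) (si t) @^-1` X) = g2 X.
Proof.
move=> mX; have := gauss2_rot (co_gt0 t) (co_si t) mX.
rewrite (probE gauss2 mX).
rewrite (probE _ (measurable_preimageT (measurable_rot _ _) mX)) => h.
exact: EFin_inj h.
Qed.

Lemma measurable_strip t a : measurable (strip t a).
Proof.
rewrite strip_rot; exact: measurable_preimageT (measurable_rot _ _) (measurable_slab _).
Qed.

Lemma g2_strip t a : g2 (strip t a) = g1 (seg (- (a * co t)) (a * co t)).
Proof. by rewrite strip_rot g2_rot ?g2_slab//; exact: measurable_slab. Qed.

Let co_le1 t : co t <= 1.
Proof. by rewrite invf_le1// slope_norm_ge1. Qed.

Lemma g2_strip_le t a : 0 <= a -> g2 (strip t a) <= a.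
Proof.
move=> a0; have a'0 : 0 <= a * co t by rewrite mulr_ge0// ltW.
rewrite g2_strip (le_trans (g1_seg_le _))//; first lra.
rewrite (_ : _ / 2 = a * co t); last by field.
by rewrite ler_piMr.
Qed.

Lemma g2_strip_ge t : exists2 c, 0 < c &
  forall a, 0 <= a <= 1 -> c * a <= g2 (strip t a).
Proof.
exists (gpdf 1 * co t); first by rewrite mulr_gt0// gpdfE mulr_gt0 ?expR_gt0//
   invr_gt0 sqrtr_gt0 mulrn_wgt0// pi_gt0.
move=> a /andP[a0 a1]; rewrite g2_strip -mulrA [co t * a]mulrC; apply: g1_seg_ge.
by rewrite mulr_ge0 ?(ltW (co_gt0 t))//= mulr_ile1// ltW.
Qed.

(** After rotation two segments of length at most [d] are removed, each of mass at most [d / 2]. *)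
Lemma g2_strip_shrink t a d : 0 <= a -> 0 <= d ->
  g2 (strip t a) - d <= g2 (strip t (a - d)).
Proof.
move=> a0 d0; rewrite !g2_strip.
set a' := a * co t; set d' := d * co t.
have -> : (a - d) * co t = a' - d' by rewrite mulrBl.
have d'd : d' <= d by rewrite ler_piMr.
have d'0 : 0 <= d' by rewrite mulr_ge0// ltW.
have a'0 : 0 <= a' by rewrite mulr_ge0// ltW.
have sub : seg (- a') a' `<=`
    (seg (- (a' - d')) (a' - d') `|` seg (- a') (- (a' - d'))) `|` seg (a' - d') a'.
  move=> x; rewrite /seg/= !in_itv/= => xa.
  have [h|h] := leP (- (a' - d')) x; have [k|k] := leP x (a' - d').
  - by left; left; lra.
  - by right; lra.
  - by left; right; lra.
  - by right; lra.
have mU A B : measurable A -> measurable B -> measurable (A `|` B : set line).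
  exact: measurableU.
have := prob_mono gauss1 (measurable_seg _ _)
  (mU _ _ (mU _ _ (measurable_seg _ _) (measurable_seg _ _)) (measurable_seg _ _)) sub.
have := prob_U gauss1
  (mU _ _ (measurable_seg (- (a' - d')) (a' - d')) (measurable_seg (- a') (- (a' - d'))))
  (measurable_seg (a' - d') a').
have := prob_U gauss1 (measurable_seg (- (a' - d')) (a' - d'))
   (measurable_seg (- a') (- (a' - d'))).
have := @g1_seg_le (- a') (- (a' - d')) ltac:(lra).
have := @g1_seg_le (a' - d') a' ltac:(lra).
by lra.
Qed.

Lemma convex2_strip t a : convex2 (strip t a).
Proof.
move=> z z'; rewrite /strip/= => h h' k /andP[k0 k1].
rewrite (_ : _ + _ = k * (z.1 + t * z.2) + (1 - k) * (z'.1 + t * z'.2)); last by ring.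
move: h h'; rewrite !ler_norml => /andP[h1 h2] /andP[h3 h4].
set u := z.1 + _ in h1 h2 *; set v := z'.1 + _ in h3 h4 *.
by nra.
Qed.

Lemma symmetric2_strip t a : centrally_symmetric2 (strip t a).
Proof. by move=> z; rewrite /strip/= mulrN -opprD normrN. Qed.

Lemma g2_strip_correlation t a (X : set plane) : 0 <= a -> measurable X ->
  convex2 X -> centrally_symmetric2 X ->
  g2 (strip t a) * g2 X <= g2 (strip t a `&` X).
Proof.
move=> a0 mX cX sX.
pose X' : set plane := rot (co t) (- si t) @^-1` X.
have XX' : X = rot (co t) (si t) @^-1` X' by rewrite unrot.
have mX' : measurable X' by exact: measurable_preimageT (measurable_rot _ _) mX.
have mS := measurable_slab (a * co t).
rewrite XX' strip_rot -preimage_setI !g2_rot//; last exact: measurableI.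
apply: g2_slab_correlation => //.
- by rewrite mulr_ge0// ltW.
- move=> u v; rewrite /X'/= => Xu Xv k k01; have := cX _ _ Xu Xv k k01.
  by rewrite /rot/=; congr X; congr (_, _);
    move: (u.1) (u.2) (v.1) (v.2) => /= u1 u2 v1 v2;
    set x1 : R := u1; set x2 : R := u2; set y1 : R := v1; set y2 : R := v2; ring.
- move=> u; rewrite /X'/= => Xu; have := sX _ Xu.
  by rewrite /rot/=; congr X; congr (_, _);
    move: (u.1) (u.2) => /= u1 u2; set x1 : R := u1; set x2 : R := u2; ring.
Qed.

(** Rotate the first strip into a slab. The form [z.1 + t' * z.2] becomes [al * z.1 + be * z.2], and
    its strip meets each vertical line in a segment of half-width [b / |be|], hence of at most that
    mass; the slab contributes at most [a]. *)
Lemma g2_strip2_le t t' : t != t' -> exists2 K, 0 <= K &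
  forall a b, 0 <= a -> 0 <= b -> g2 (strip t a `&` strip t' b) <= K * a * b.
Proof.
move=> tt'; pose be := (t' - t) * co t; pose al := (1 + t' * t) * co t.
have be0 : 0 < `|be|.
  by rewrite normr_gt0 /be mulf_eq0 negb_or subr_eq0 eq_sym tt' gt_eqF.
exists `|be|^-1; first by rewrite invr_ge0.
move=> a b a0 b0.
pose X' : set plane := rot (co t) (- si t) @^-1` strip t' b.
have mX' : measurable X'.
  exact: measurable_preimageT (measurable_rot _ _) (measurable_strip _ _).
have X'E : X' = [set z | `|al * z.1 + be * z.2| <= b].
  apply/funext => z; rewrite /X' /strip /rot /=.
  congr (`|_| <= _); rewrite /al /be /si; move: (z.1) (z.2) => /= u1 u2.
  by set x1 : R := u1; set x2 : R := u2; rewrite /co; ring.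
have -> : strip t' b = rot (co t) (si t) @^-1` X' by rewrite unrot.
have mS := measurable_slab (a * co t).
have mSX : measurable (slab (a * co t) `&` X') by exact: measurableI.
rewrite strip_rot -preimage_setI g2_rot//.
have mI : measurable (seg (- (a * co t)) (a * co t)) by [].
suff : (gauss2 (slab (a * co t) `&` X') <=
    (b / `|be|)%:E * gauss1 (seg (- (a * co t)) (a * co t)))%E.
  rewrite (probE gauss2 mSX) (probE gauss1 mI) -EFinM lee_fin => /le_trans; apply.
  rewrite -g2_strip [leRHS](_ : _ = (b / `|be|) * a); last by ring.
  by rewrite ler_wpM2l ?g2_strip_le// divr_ge0// ltW.
have k0 : 0 <= b / `|be| by rewrite divr_ge0// ltW.
have -> : ((b / `|be|)%:E * gauss1 (seg (- (a * co t)) (a * co t)) =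
    \int[gauss1]_x ((b / `|be|)%:E * (\1_(seg (- (a * co t)) (a * co t)) x)%:E))%E.
  rewrite ge0_integralZl//; last first.
    by apply/measurable_EFinP; exact: measurable_indic.
  by rewrite integral_indic// setIT.
rewrite gauss2_xsection; apply: ge0_le_integral => //.
- exact: measurable_gauss1_xsection.
- by apply: emeasurable_funM => //; apply/measurable_EFinP; exact: measurable_indic.
- move=> x _; rewrite indicE; have [xI|] := boolP (x \in _); last first.
    rewrite notin_setE /seg/= in_itv/= -ler_norml => xa.
    rewrite mule0 (_ : xsection _ _ = set0) ?measure0//.
    by rewrite xsectionE; apply/seteqP; split => y //= -[].
  rewrite mule1; pose m := - (al * x) / be; pose w := b / `|be|.
  apply: (@le_trans _ _ (gauss1 (seg (m - w) (m + w)))).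
    rewrite le_measure ?inE//; first exact: measurable_xsection.
    rewrite xsectionE X'E => y [_ /= yb]; rewrite /seg/= in_itv/= -ler_distl.
    rewrite /w ler_pdivlMr// -normrM (_ : _ * be = al * x + be * y)//.
    by rewrite /m mulrBl divfK -?normr_gt0//; ring.
  rewrite (probE gauss1 (measurable_seg _ _)) lee_fin.
  by rewrite (le_trans (g1_seg_le _))// /w; have := k0; lra.
Qed.

End Strips.

(** * Symmetric polygons with prescribed slopes *)

Section Polygons.
Context {R : realType}.
Notation plane := (measurableTypeR R * measurableTypeR R)%type.
Notation gauss2 := (@gauss2 R).
Notation g2 := (prob gauss2).
Implicit Types (s : seq R) (h : R -> R) (z : plane).

(** With the slopes fixed, intersection is the pointwise minimum of widths. A negative width at a
    slope of [s] is allowed and makes the polygon empty, as happens to [halves] for large [v]. *)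
Definition polygon s h : set plane :=
  [set z | forall t, t \in s -> `|z.1 + t * z.2| <= h t].

Lemma polygon_cons t s h : polygon (t :: s) h = strip t (h t) `&` polygon s h.
Proof.
apply/seteqP; split=> [z zP|z [zt zs] u].
  by split=> [|u us]; apply: zP; rewrite inE ?eqxx ?us ?orbT.
by rewrite inE => /predU1P[->|/zs].
Qed.

Lemma measurable_polygon s h : measurable (polygon s h).
Proof.
elim: s => [|t s IH].
  rewrite (_ : polygon [::] h = [set: plane]); first exact: measurableT.
  by apply/seteqP; split.
by rewrite polygon_cons; apply: measurableI => //; exact: measurable_strip.
Qed.

Lemma polygon_strip s h t : t \in s -> polygon s h `<=` strip t (h t).
Proof. by move=> ts z; exact. Qed.

Lemma polygonI s h h' :
  polygon s h `&` polygon s h' = polygon s (fun t => Num.min (h t) (h' t)).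
Proof.
apply/seteqP; split=> [z [zh zh'] t ts|z zm]; first by rewrite le_min zh ?zh'.
by split=> t ts; have := zm t ts; rewrite le_min => /andP[].
Qed.

Lemma convex2_polygon s h : convex2 (polygon s h).
Proof.
by move=> z z' zP z'P k k01 t ts; apply: convex2_strip => //; [exact: zP|exact: z'P].
Qed.

Lemma symmetric2_polygon s h : centrally_symmetric2 (polygon s h).
Proof. by move=> z zP t ts; apply: symmetric2_strip; exact: zP. Qed.

Lemma g2_polygon_empty s h t : t \in s -> h t < 0 -> g2 (polygon s h) = 0.
Proof.
move=> ts ht; rewrite (_ : polygon s h = set0) ?prob_set0//.
apply/seteqP; split => // z /(_ t ts) => zt.
by have := le_lt_trans zt ht; rewrite ltNge normr_ge0.
Qed.

Lemma g2_polygon_le_strip s h t : t \in s ->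
  g2 (polygon s h) <= g2 (strip t (h t)).
Proof.
move=> ts; apply: prob_mono; [exact: measurable_polygon|exact: measurable_strip|].
exact: polygon_strip.
Qed.

Lemma seq_uniform_bound (T : eqType) (s : seq T) (Q : T -> R -> Prop) :
  (forall t K K', Q t K -> K <= K' -> Q t K') ->
  (forall t, t \in s -> exists K, Q t K) ->
  exists2 K, 1 <= K & forall t, t \in s -> Q t K.
Proof.
move=> mono; elim: s => [|t s IH] ex; first by exists 1.
have [K K1 KP] := IH (fun u us => ex u ltac:(by rewrite inE us orbT)).
have [K' K'P] := ex t (mem_head _ _).
exists (Num.max K K'); first by rewrite le_max K1.
move=> u; rewrite inE => /predU1P[->|/KP h].
  by apply: mono K'P _; rewrite le_max lexx orbT.
by apply: mono h _; rewrite le_max lexx.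
Qed.

Lemma seq_argmin s (p : pred R) (f : R -> R) : (exists2 t, t \in s & p t) ->
  exists t, [/\ t \in s, p t & forall u, u \in s -> p u -> f t <= f u].
Proof.
elim: s => [[t]//|t s IH] [u]; rewrite inE => us pu.
have [/IH[v [vs pv vmin]]|none] := pselect (exists2 t, t \in s & p t); last first.
  have ut : u = t by case/predU1P: us => // us; case: none; exists u.
  exists t; rewrite mem_head -{1}ut; split => // w; rewrite inE.
  by case/predU1P => [->//|ws pw]; case: none; exists w.
have [pt|npt] := boolP (p t); last first.
  exists v; rewrite inE vs orbT; split => // w; rewrite inE.
  by case/predU1P => [->|]; [rewrite (negbTE npt)|exact: vmin].
have [tv|vt] := leP (f t) (f v).
  exists t; rewrite mem_head; split => // w; rewrite inE.
  by case/predU1P => [->//|ws pw]; exact: le_trans tv (vmin _ ws pw).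
exists v; rewrite inE vs orbT; split => // w; rewrite inE.
by case/predU1P => [->|]; [rewrite ltW|exact: vmin].
Qed.

(* For a finite set of slopes one K serves all triples; distinct directions
   i, j control every other width l. *)
Definition strip_constant (i j l K : R) :=
  (forall a, 0 <= a <= 1 -> a <= K * g2 (strip i a)) /\
  (i != j ->
    [/\ forall a b, 0 <= a -> 0 <= b ->
         g2 (strip i a `&` strip j b) <= K * (a * b),
       l != i -> `|j - i| <= K * `|l - i|
     & forall z m, `|z.1 + i * z.2| <= m -> `|z.1 + j * z.2| <= m ->
         `|z.1 + l * z.2| <= K * m]).

Lemma strip_constant_mono i j l K K' :
  strip_constant i j l K -> K <= K' -> strip_constant i j l K'.
Proof.
move=> [h1 h2] KK'; split=> [a a01|ij].
  by apply: (le_trans (h1 a a01)); rewrite ler_wpM2r// prob_nneg.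
have [h3 h4 h5] := h2 ij; split=> [a b a0 b0|li|z m zi zj].
- by apply: (le_trans (h3 a b a0 b0)); rewrite ler_wpM2r// mulr_ge0.
- by apply: (le_trans (h4 li)); rewrite ler_wpM2r.
- by apply: (le_trans (h5 z m zi zj)); rewrite ler_wpM2r// (le_trans _ zi).
Qed.

Lemma strip_constant_ex i j l : exists K, strip_constant i j l K.
Proof.
have [c c0 cP] := g2_strip_ge i.
have h1 a : 0 <= a <= 1 -> a <= c^-1 * g2 (strip i a).
  by move=> a01; rewrite mulrC ler_pdivlMr// mulrC cP.
have [ij|ij] := eqVneq i j; first by exists c^-1; split; rewrite // ij eqxx.
have [K0 K00 K0P] := g2_strip2_le ij.
(* These are the coefficients in [(1, l) = a (1, i) + b (1, j)]. *)
pose a := (l - j) / (i - j); pose b := (i - l) / (i - j).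
pose K1 := `|j - i| / `|l - i|.
have K10 : 0 <= K1 by rewrite divr_ge0.
have c'0 : 0 <= c^-1 by rewrite invr_ge0 ltW.
have ab0 : 0 <= `|a| + `|b| by rewrite addr_ge0.
exists (c^-1 + K0 + K1 + (`|a| + `|b|)); split=> [d d01|_].
  apply: (le_trans (h1 d d01)); rewrite ler_wpM2r ?prob_nneg//; lra.
split=> [d e d0 e0|li|z m zi zj].
- apply: (le_trans (K0P d e d0 e0)); rewrite -mulrA ler_wpM2r ?mulr_ge0//; lra.
- apply: (@le_trans _ _ (K1 * `|l - i|)).
    by rewrite /K1 divfK// normr_eq0 subr_eq0.
  by rewrite ler_wpM2r//; lra.
- have ij0 : i - j != 0 by rewrite subr_eq0.
  have -> : z.1 + l * z.2 = a * (z.1 + i * z.2) + b * (z.1 + j * z.2).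
    by rewrite /a /b; move: (z.1) (z.2) => /= x y;
      set u : R := x; set v : R := y; field.
  have m0 : 0 <= m := le_trans (normr_ge0 _) zi.
  apply: (@le_trans _ _ ((`|a| + `|b|) * m)); last by rewrite ler_wpM2r//; lra.
  apply: (le_trans (ler_normD _ _)); rewrite !normrM mulrDl.
  by apply: lerD; apply: ler_wpM2l.
Qed.

Lemma strip_constants s : exists2 K, 1 <= K &
  forall i j l, i \in s -> j \in s -> l \in s -> strip_constant i j l K.
Proof.
have [K K1 KP] := @seq_uniform_bound _
  [seq (p, l) | p <- [seq (i, j) | i <- s, j <- s], l <- s]
  (fun p => strip_constant p.1.1 p.1.2 p.2)
  (fun p => @strip_constant_mono p.1.1 p.1.2 p.2)
  (fun p _ => strip_constant_ex p.1.1 p.1.2 p.2).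
exists K => // i j l si sj sl.
by apply: (KP (i, j, l)); do 2 apply: allpairs_f => //.
Qed.

End Polygons.

(** * Polygons with a small width *)

Section ThinPolygons.
Context {R : realType}.
Notation plane := (measurableTypeR R * measurableTypeR R)%type.
Notation gauss2 := (@gauss2 R).
Notation g2 := (prob gauss2).
Implicit Types (h : R -> R) (z : plane).
Variables (s : seq R) (K : R).
Hypothesis K1 : 1 <= K.
Hypothesis KP : forall i j l, i \in s -> j \in s -> l \in s -> strip_constant i j l K.

(** The exponent is 4 + 2: [K ^+ 4] is lost in bounding the mass of the intersection from below by
    its two smallest widths, and [K ^+ 2] in bounding the product of the two masses from above. *)
Let rho := (K ^+ 6)^-1.

Let K0 : 0 < K. Proof. exact: lt_le_trans K1. Qed.
Let rho0 : 0 < rho. Proof. by rewrite invr_gt0 exprn_gt0. Qed.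
Let Krho : K ^+ 6 * rho = 1.
Proof. by rewrite divff// gt_eqF// exprn_gt0. Qed.
Let Knrho n : (n <= 6)%N -> K ^+ n * rho <= 1.
Proof. by move=> n6; rewrite -Krho ler_wpM2r ?(ltW rho0)// ler_weXn2l. Qed.
Let rho1 : rho <= 1. Proof. by have := @Knrho 0 isT; rewrite mul1r. Qed.

Lemma g2_cap_strip t a (X Y : set plane) : 0 <= a -> measurable X ->
  convex2 X -> centrally_symmetric2 X -> measurable Y ->
  strip t a `&` X `<=` Y -> g2 (strip t a) * g2 X <= g2 Y.
Proof.
move=> a0 mX cX sX mY sub; apply: (le_trans (g2_strip_correlation _ a0 mX cX sX)).
by apply: prob_mono => //; apply: measurableI => //; exact: measurable_strip.
Qed.

Lemma g2_polygon_le_strip2 h i j : i \in s -> j \in s -> i != j ->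
  0 <= h i -> 0 <= h j -> g2 (polygon s h) <= K * (h i * h j).
Proof.
move=> si sj ij hi hj; have [_ /(_ ij)[bound _ _]] := KP si sj sj.
apply: le_trans (bound _ _ hi hj); apply: prob_mono.
- exact: measurable_polygon.
- by apply: measurableI; exact: measurable_strip.
- by move=> z zP; split; exact: zP.
Qed.

Section TwoThinDirections.
Variables (h h' : R -> R) (i j : R).
Let m t := Num.min (h t) (h' t).
Hypotheses (si : i \in s) (sj : j \in s) (ij : i != j) (mi0 : 0 <= m i).
Hypothesis mi : forall l, l \in s -> m i <= m l.
Hypothesis mj : forall l, l \in s -> l != i -> m j <= m l.
Hypothesis hi : h i <= h' i.
Hypothesis jsmall : m j < rho.

Let m_h t : m t <= h t. Proof. by rewrite ge_min lexx. Qed.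
Let m_h' t : m t <= h' t. Proof. by rewrite ge_min lexx orbT. Qed.
Let m0 t : t \in s -> 0 <= m t. Proof. by move=> /mi; exact: le_trans. Qed.
Let h0 t : t \in s -> 0 <= h t. Proof. by move=> /m0/le_trans; apply. Qed.
Let h'0 t : t \in s -> 0 <= h' t. Proof. by move=> /m0/le_trans; apply. Qed.
Let him : h i = m i. Proof. by rewrite /m min_l. Qed.

(** Shrink the strips [i] and [j] by the factor [K]: on their intersection every other form is at
    most [m j], so it lies in the polygon. Strip correlation bounds its mass from below, each strip
    costing one [K] for the shrinking and one for mass against width. *)
Let lower : m i * m j <= K ^+ 4 * g2 (polygon s m).
Proof.
have mij : m i <= m j by exact: mi.
have mj0 := m0 sj.
have mjK : m j / K <= 1 by rewrite ler_pdivrMr// mul1r (le_trans (ltW jsmall))// (le_trans rho1).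
have miK : m i / K <= m j / K by rewrite ler_wpM2r// invr_ge0 ltW.
have [ci /(_ ij)[_ _ _]] := KP si sj sj; have [cj _] := KP sj si si.
have mK0 t : t \in s -> 0 <= m t / K by move=> /m0 ?; rewrite divr_ge0// ltW.
have := ci _ (introT andP (conj (mK0 _ si) (le_trans miK mjK))).
have := cj _ (introT andP (conj (mK0 _ sj) mjK)).
rewrite !ler_pdivrMr// => hj hi'.
have : g2 (strip i (m i / K)) * g2 (strip j (m j / K)) <= g2 (polygon s m).
  apply: g2_cap_strip; rewrite ?mK0//.
  - exact: measurable_strip.
  - exact: convex2_strip.
  - exact: symmetric2_strip.
  - exact: measurable_polygon.
  move=> z [zi zj] l sl.
  have [->|li] := eqVneq l i.
    by apply: (le_trans zi); rewrite ler_pdivrMr// ler_peMr.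
  have [_ /(_ ij)[_ _]] := KP si sj sl.
  move=> /(_ z (m j / K) (le_trans zi miK) zj) /le_trans; apply.
  by rewrite mulrC divfK ?gt_eqF// mj.
have g0 t a := prob_nneg gauss2 (strip t a).
move: hi' hj (g0 i (m i / K)) (g0 j (m j / K)).
set x := g2 (strip i _); set y := g2 (strip j _) => hx hy x0 y0 xy.
have := ler_pM (m0 si) mj0 hx hy.
rewrite (_ : K * x * K * (K * y * K) = K ^+ 4 * (x * y)); last by ring.
by move=> /le_trans; apply; rewrite ler_wpM2l// exprn_ge0// ltW.
Qed.

Let below (x : R) : x <= K ^+ 2 * rho * (m i * m j) -> x <= g2 (polygon s m).
Proof.
move=> /le_trans; apply; apply: (@le_trans _ _ (K ^+ 2 * rho * (K ^+ 4 * g2 (polygon s m)))).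
  by rewrite ler_wpM2l// mulr_ge0 ?exprn_ge0 ?ltW.
by rewrite mulrACA -exprD mulrA Krho mul1r.
Qed.

Lemma two_thin_directions : g2 (polygon s h) * g2 (polygon s h') <= g2 (polygon s m).
Proof.
have gA := prob_nneg gauss2 (polygon s h).
have gB := prob_nneg gauss2 (polygon s h').
have gA1 := prob_leone gauss2 (measurable_polygon s h).
have gB1 := prob_leone gauss2 (measurable_polygon s h').
have mA := measurable_polygon s h.
have mB := measurable_polygon s h'.
have mM := measurable_polygon s m.
have Kr0 : 0 <= K * rho by rewrite mulr_ge0 ?ltW.
have [hj|hj] := leP (h j) (h' j).
(* Both small widths belong to the first polygon. Either the second one has two widths below
   [K * rho], and its mass is tiny; or only its narrowest strip [l1] can cut the first polygon,
   whose widths are all at most [K * rho]. *)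
- have hjm : h j = m j by rewrite /m min_l.
  have gAle : g2 (polygon s h) <= K * (m i * m j).
    by rewrite -him -hjm; apply: g2_polygon_le_strip2; rewrite ?h0.
  have [l1 [sl1 _ l1min]] := @seq_argmin _ s predT h' (ex_intro2 _ _ i si isT).
  have [[l [sl ll1 l2small]]|big] := pselect
      (exists l, [/\ l \in s, l != l1 & h' l < K * rho]).
    have gBle : g2 (polygon s h') <= K * (K * rho * (K * rho)).
      apply: (le_trans (g2_polygon_le_strip2 sl sl1 ll1 (h'0 sl) (h'0 sl1))).
      rewrite ler_wpM2l ?(ltW K0)// ler_pM ?h'0// ltW//.
      by apply: le_lt_trans l2small; exact: l1min.
    apply: below; apply: (le_trans (ler_pM gA gB gAle gBle)).
    have x0 : 0 <= m i * m j by rewrite mulr_ge0 ?m0.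
    rewrite [leLHS](_ : _ = K ^+ 2 * rho * (m i * m j) * (K ^+ 2 * rho)); last by ring.
    by rewrite ler_piMr ?Knrho// mulr_ge0// mulr_ge0 ?exprn_ge0 ?ltW.
  rewrite mulrC; apply: (@le_trans _ _ (g2 (strip l1 (h' l1)) * g2 (polygon s h))).
    by rewrite ler_wpM2r// g2_polygon_le_strip.
  apply: g2_cap_strip => //; [exact: h'0|exact: convex2_polygon|
    exact: symmetric2_polygon|].
  rewrite -polygonI => z [zl1 zA]; split => // l sl.
  have [->//|ll1] := eqVneq l l1.
  have Kl : K * rho <= h' l by rewrite leNgt; apply/negP => ?; apply: big; exists l.
  apply: le_trans Kl; apply: (@le_trans _ _ (K * m j)).
    have [_ /(_ ij)[_ _]] := KP si sj sl; apply.
      by apply: (le_trans (zA i si)); rewrite him; exact: mi.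
    by rewrite -hjm; exact: zA.
  by rewrite ler_wpM2l ?ltW.
(* Each polygon is thin in a direction of its own. If a third width of the intersection is below
   [K * m j], the polygon it comes from has two small widths; otherwise the strips [i] and [j] alone
   cut out the intersection. *)
- have hjm : h' j = m j by rewrite /m min_r// ltW.
  have gAi : g2 (polygon s h) <= m i.
    by rewrite -him (le_trans (g2_polygon_le_strip _ si))// g2_strip_le// h0.
  have gBj : g2 (polygon s h') <= m j.
    by rewrite -hjm (le_trans (g2_polygon_le_strip _ sj))// g2_strip_le// h'0.
  have [[l [sl li lj lsmall]]|big] := pselect
      (exists l, [/\ l \in s, l != i, l != j & m l < K * m j]).
    have lK : m l <= K * rho.
      by rewrite ltW// (lt_trans lsmall)// ltr_pM2l.
    apply: below.
    have [hl|hl] := leP (h l) (h' l).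
      have hlm : h l = m l by rewrite /m min_l.
      have : g2 (polygon s h) <= K * (m i * (K * rho)).
        apply: (le_trans (g2_polygon_le_strip2 si sl _ (h0 si) (h0 sl))).
          by rewrite eq_sym.
        by rewrite him hlm ler_wpM2l ?(ltW K0)// ler_wpM2l// m0.
      move=> gA'; apply: (le_trans (ler_pM gA gB gA' gBj)).
      by rewrite le_eqVlt; apply/orP; left; apply/eqP; ring.
    have hlm : h' l = m l by rewrite /m min_r// ltW.
    have : g2 (polygon s h') <= K * (m j * (K * rho)).
      apply: (le_trans (g2_polygon_le_strip2 sj sl _ (h'0 sj) (h'0 sl))).
        by rewrite eq_sym.
      by rewrite hjm hlm ler_wpM2l ?(ltW K0)// ler_wpM2l// m0.
    move=> gB'; apply: (le_trans (ler_pM gA gB gAi gB')).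
    by rewrite le_eqVlt; apply/orP; left; apply/eqP; ring.
  apply: (@le_trans _ _ (g2 (strip i (m i)) * g2 (strip j (m j)))).
    by rewrite ler_pM// -?him -?hjm g2_polygon_le_strip.
  apply: g2_cap_strip => //; [exact: measurable_strip|exact: convex2_strip|
    exact: symmetric2_strip|].
  move=> z [zi zj] l sl.
  have [->//|li] := eqVneq l i; have [->//|lj] := eqVneq l j.
  have Kl : K * m j <= m l by rewrite leNgt; apply/negP => ?; apply: big; exists l.
  apply: le_trans Kl; have [_ /(_ ij)[_ _]] := KP si sj sl; apply => //.
  by apply: (le_trans zi); exact: mi.
Qed.

End TwoThinDirections.

Section OneThinDirection.
Variables (h h' : R -> R) (i e : R).
Hypotheses (e0 : 0 < e) (e1 : e <= 1).
Hypotheses (si : i \in s) (hi0 : 0 <= h i).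
Hypothesis hi : h i <= h' i.
Hypothesis hismall : (1 + K) * h i <= e * (rho / K).
Hypothesis big : forall l, l \in s -> l != i -> rho <= h' l.
Hypothesis other : exists2 j, j \in s & j != i.

(* If only the direction i is thin, then inside polygon s h the polygon
   polygon s h' is almost cut out by the single strip j that comes first along
   the line of direction i. *)
Lemma one_thin_direction :
  (1 - e) * (g2 (polygon s h) * g2 (polygon s h')) <=
  g2 (polygon s h `&` polygon s h').
Proof.
(* On the line [z.1 + i * z.2 = 0] the form of slope [l] is [(l - i) * z.2], so strip [l] ends at
   height [h' l / |l - i|]; [j] is the lowest of these. *)
have [j [sj ji jmin]] := seq_argmin (fun l => h' l / `|l - i|) other.
(* Shrinking strip [j] by [d] must absorb the error [(1 + K) * h i] due to the positive width in
   direction [i], and may cost at most the fraction [e] of its mass, which is at least [rho / K]. *)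
pose d := e * (rho / K).
have rK0 : 0 < rho / K by rewrite divr_gt0.
have rKr : rho / K <= rho by rewrite ler_pdivrMr// ler_peMr// ltW.
have d0 : 0 <= d by rewrite mulr_ge0 ?ltW.
have drho : d <= rho by apply: le_trans rKr; rewrite ler_piMl// ltW.
have hjr := big sj ji.
have mA := measurable_polygon s h.
have sub : strip j (h' j - d) `&` polygon s h `<=` polygon s h `&` polygon s h'.
  move=> z [zj zA]; split => // l sl; have zi := zA i si.
  have [->|li] := eqVneq l i; first exact: le_trans zi hi.
  have := jmin l sl li; have [_ /(_ _)[|_ /(_ li) pq _]] := KP si sj sl.
    by rewrite eq_sym.
  have p0 : 0 < `|j - i| by rewrite normr_gt0 subr_eq0.
  have q0 : 0 < `|l - i| by rewrite normr_gt0 subr_eq0.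
  rewrite ler_pdivrMr// mulrAC ler_pdivlMr// => jl.
  have pz : `|j - i| * `|z.2| <= h' j - d + h i.
    rewrite -normrM (_ : _ * _ = (z.1 + j * z.2) - (z.1 + i * z.2)); last by ring.
    by apply: (le_trans (ler_normB _ _)); apply: lerD => //; exact: zj.
  have : `|z.1 + l * z.2| <= h i + `|l - i| * `|z.2|.
    rewrite -normrM (_ : z.1 + l * z.2 = (z.1 + i * z.2) + (l - i) * z.2); last by ring.
    by apply: (le_trans (ler_normD _ _)); apply: lerD.
  move=> /le_trans; apply; rewrite -(ler_pM2l p0).
  move: p0 q0 jl pz pq; move: hismall; rewrite -/d.
  move: (`|z.2|) (`|j - i|) (`|l - i|) (h i) (h' j) (h' l) hi0 => y p q a b c a0.
  move=> da p0 q0 jl pz pq.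
  have t1 : q * (p * y) <= q * (b - d + a) := ler_wpM2l (ltW q0) pz.
  have t2 : q * ((1 + K) * a) <= q * d := ler_wpM2l (ltW q0) da.
  have t3 : p * a <= K * q * a by rewrite ler_wpM2r.
  lra.
have gj : d <= e * g2 (strip j (h' j)).
  rewrite ler_wpM2l ?(ltW e0)//.
  apply: (@le_trans _ _ (g2 (strip j rho))); last first.
    apply: prob_mono; [exact: measurable_strip..|].
    by move=> z /= /le_trans; apply.
  have [c _] := KP sj sj sj; rewrite ler_pdivrMr// mulrC.
  by apply: c; rewrite (ltW rho0) rho1.
have shrink := @g2_strip_shrink _ j (h' j) d (le_trans (ltW rho0) hjr) d0.
have := @g2_cap_strip j (h' j - d) _ _ _ mA (convex2_polygon (h:=h) (s:=s))
  (symmetric2_polygon (h:=h) (s:=s)) (measurableI _ _ mA (measurable_polygon s h')) sub.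
have hjd : 0 <= h' j - d by rewrite subr_ge0 (le_trans drho).
move=> /(_ hjd) /(le_trans _); apply.
rewrite mulrCA mulrC ler_wpM2r ?prob_nneg//.
apply: le_trans shrink; apply: (@le_trans _ _ ((1 - e) * g2 (strip j (h' j)))).
  by apply: ler_wpM2l; [rewrite subr_ge0|exact: g2_polygon_le_strip].
by lra.
Qed.

End OneThinDirection.

Lemma thin_polygons_ordered (h h' : R -> R) (i e : R) :
  0 < e <= 1 -> i \in s -> (exists2 j, j \in s & j != i) ->
  (forall l, l \in s -> h i <= h l /\ h i <= h' l) ->
  (1 + K) * h i <= e * (rho / K) ->
  (1 - e) * (g2 (polygon s h) * g2 (polygon s h')) <=
  g2 (polygon s h `&` polygon s h').
Proof.
move=> /andP[e0 e1] si other imin ismall.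
have [hi0|hi0] := leP 0 (h i); last first.
  by rewrite (g2_polygon_empty si hi0) mul0r mulr0 prob_nneg.
(* [j] has the second smallest width. If it is at least [rho], only [i] is thin; otherwise two
   directions are thin and the inequality holds without the loss [e]. *)
have [j [sj ji jmin]] := seq_argmin (fun l => Num.min (h l) (h' l)) other.
have hi : h i <= h' i by case: (imin i si).
have [jsmall|jbig] := ltP (Num.min (h j) (h' j)) rho; last first.
  apply: (@one_thin_direction h h' i e) => // l sl li.
  by have := le_trans jbig (jmin l sl li); rewrite le_min => /andP[].
rewrite polygonI; apply: le_trans (two_thin_directions si sj _ _ _ jmin hi jsmall).
- by rewrite ler_piMl ?mulr_ge0 ?prob_nneg//; lra.
- by rewrite eq_sym.
- by rewrite min_l.
- by move=> l sl; rewrite min_l// le_min; case: (imin l sl) => -> ->.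
Qed.

End ThinPolygons.

Section ThinPolygonsThm.
Context {R : realType}.
Notation gauss2 := (@gauss2 R).
Notation g2 := (prob gauss2).

(** One [r] serves all widths because [K] and [rho] depend on the slopes only. By exchanging the
    polygons, the smallest width may be taken to belong to the first. *)
Lemma thin_polygons (s : seq R) (e : R) : 0 < e <= 1 ->
  (forall i, i \in s -> exists2 j, j \in s & j != i) ->
  exists2 r, 0 < r & forall h h' : R -> R,
    (exists2 t, t \in s & (h t < r) || (h' t < r)) ->
    (1 - e) * (g2 (polygon s h) * g2 (polygon s h')) <=
    g2 (polygon s h `&` polygon s h').
Proof.
move=> e01 other; have [K K1 KP] := strip_constants s.
have K0 : 0 < K := lt_le_trans ltr01 K1.
pose rho := (K ^+ 6)^-1; have rho0 : 0 < rho by rewrite invr_gt0 exprn_gt0.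
have K10 : 0 < 1 + K by lra.
have e0 : 0 < e by case/andP: e01.
exists (e * (rho / K) / (1 + K)) => [|h h' [t st small]].
  by rewrite divr_gt0// mulr_gt0// divr_gt0.
have [i [si _ imin]] := @seq_argmin _ s predT (fun l => Num.min (h l) (h' l))
  (ex_intro2 _ _ t st isT).
have mi : (1 + K) * Num.min (h i) (h' i) <= e * (rho / K).
  rewrite mulrC -ler_pdivlMr// ltW//; apply: le_lt_trans (imin t st isT) _.
  by rewrite gt_min.
have [hi|hi] := leP (h i) (h' i).
  apply: (thin_polygons_ordered K1 KP e01 si (other i si)); last first.
    by move: mi; rewrite min_l.
  move=> l sl; have := imin l sl isT; rewrite min_l// le_min.
  by move=> /andP[].
rewrite setIC [_ * g2 (polygon s h')]mulrC.
apply: (thin_polygons_ordered K1 KP e01 si (other i si)); last first.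
  by move: mi; rewrite min_r// ltW.
move=> l sl; have := imin l sl isT; rewrite min_r ?(ltW hi)// le_min.
by move=> /andP[].
Qed.

End ThinPolygonsThm.

(** * Regrouping the coordinates of a pair of points *)

Section ProductTransposition.
Context d (T : measurableType d) (R : realType) (P : probability T R).
Let P2 : probability (T * T)%type R := (P \x P)%E.
Notation P4 := (P2 \x P2)%E.
Implicit Types f : (T * T) * (T * T) -> \bar R.

(** A pair of points becomes the pair of first coordinates and the pair of second coordinates, so
    that a rotation mixing the two points acts as one plane rotation in each group. *)
Definition transpose4 (p : (T * T) * (T * T)) : (T * T) * (T * T) :=
  ((p.1.1, p.2.1), (p.1.2, p.2.2)).

Lemma measurable_transpose4 : measurable_fun [set: (T * T) * (T * T)] transpose4.
Proof.
apply: measurable_fun_pair; apply: measurable_fun_pair.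
- exact: (measurableT_comp measurable_fst measurable_fst).
- exact: (measurableT_comp measurable_fst measurable_snd).
- exact: (measurableT_comp measurable_snd measurable_fst).
- exact: (measurableT_comp measurable_snd measurable_snd).
Qed.

Lemma integral_P4 f : measurable_fun [set: (T * T) * (T * T)] f ->
  (forall p, 0 <= f p)%E ->
  (\int[P4]_p f p = \int[P]_a1 \int[P]_a2 \int[P]_b1 \int[P]_b2
     f ((a1, a2), (b1, b2)))%E.
Proof.
move=> mf f0.
rewrite fubini_tonelli1//.
have mF := measurable_fun_fubini_tonelli_F (m2 := P2) f mf f0.
have F0 z : (0 <= fubini_F P2 f z)%E by apply: integral_ge0.
apply: (etrans (fubini_tonelli1 (m1 := P) (m2 := P) _ mF F0)).
apply: eq_integral => a1 _; apply: eq_integral => a2 _.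
by apply: (fubini_tonelli1 (m1 := P) (m2 := P)) => //; exact: measurable_fun_pair2.
Qed.

(** As a fourfold iterated integral, the two sides differ in the order of the two middle variables
    only. *)
Lemma integral_transpose4 f : measurable_fun [set: (T * T) * (T * T)] f ->
  (forall p, 0 <= f p)%E ->
  (\int[P4]_p f (transpose4 p) = \int[P4]_p f p)%E.
Proof.
move=> mf f0.
have mft := measurableT_comp mf measurable_transpose4.
apply: (etrans (integral_P4 mft (fun p => f0 (transpose4 p)))).
apply: (etrans _ (esym (integral_P4 mf f0))).
apply: eq_integral => a1 _.
pose h (p : (T * T) * T) := f ((a1, p.1.1), (p.1.2, p.2)).
have mh : measurable_fun [set: (T * T) * T] h.
  apply: (measurableT_comp mf); apply: measurable_fun_pair.
    apply: measurable_fun_pair; first exact: measurable_cst.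
    exact: (measurableT_comp measurable_fst measurable_fst).
  apply: measurable_fun_pair; last exact: measurable_snd.
  exact: (measurableT_comp measurable_snd measurable_fst).
have mG := measurable_fun_fubini_tonelli_F (m2 := P) h mh (fun q => f0 _).
have G0 q : (0 <= fubini_F P h q)%E by apply: integral_ge0 => b _; exact: f0.
exact: (esym (fubini_tonelli (m1 := P) (m2 := P) _ mG G0)).
Qed.

End ProductTransposition.

(** * The doubled Gaussian measure and its rotation by pi/4 *)

Section Doubling.
Context {R : realType}.
Notation line := (measurableTypeR R).
Notation plane := (measurableTypeR R * measurableTypeR R)%type.
Notation gauss2 := (@gauss2 R).

Let c : R := (Num.sqrt 2)^-1.

Let c0 : 0 < c. Proof. by rewrite invr_gt0 sqrtr_gt0. Qed.

Let cc : c ^+ 2 + c ^+ 2 = 1.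
Proof. by rewrite /c exprVn sqr_sqrtr//; field. Qed.

Lemma integral_rot (f : plane -> \bar R) : measurable_fun [set: plane] f ->
  (forall z, 0 <= f z)%E ->
  (\int[gauss2]_z f (rot c c z) = \int[gauss2]_z f z)%E.
Proof.
move=> mf f0.
have mr := measurable_rot c c.
transitivity (\int[pushforward gauss2 (rot c c)]_z f z)%E.
  by rewrite (ge0_integral_pushforward mr _ measurableT mf) => // z _; exact: f0.
by apply: eq_measure_integral => A mA _; exact: gauss2_rot.
Qed.

Lemma integral_rot2 (f : plane * plane -> \bar R) :
  measurable_fun [set: plane * plane] f -> (forall p, 0 <= f p)%E ->
  (\int[gauss2 \x gauss2]_p f (rot c c p.1, rot c c p.2) =
   \int[gauss2 \x gauss2]_p f p)%E.
Proof.
move=> mf f0; have mr := measurable_rot c c.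
have mfr : measurable_fun [set: plane * plane]
    (fun p => f (rot c c p.1, rot c c p.2)).
  apply: (measurableT_comp mf); apply: measurable_fun_pair.
    exact: (measurableT_comp mr measurable_fst).
  exact: (measurableT_comp mr measurable_snd).
apply: (etrans (fubini_tonelli1 (m1 := gauss2) (m2 := gauss2) _ mfr (fun p => f0 _))).
apply: (etrans _ (esym (fubini_tonelli1 (m1 := gauss2) (m2 := gauss2) _ mf f0))).
have mF := measurable_fun_fubini_tonelli_F (m2 := gauss2) f mf f0.
have F0 z : (0 <= fubini_F gauss2 f z)%E by apply: integral_ge0 => b _; exact: f0.
apply: (etrans _ (integral_rot mF F0)); apply: eq_integral => z _.
apply: (@integral_rot (fun w => f (rot c c z, w))) => //.
exact: measurable_fun_pair2.
Qed.

Definition halves (X : set plane) (v : plane) : set plane :=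
  [set u | X (c * v.1 + c * u.1, c * v.2 + c * u.2) /\
           X (- c * v.1 + c * u.1, - c * v.2 + c * u.2)].

Lemma measurable_halves X v : measurable X -> measurable (halves X v).
Proof.
move=> mX; apply: measurableI; apply: (measurable_preimageT _ mX);
  apply: measurable_fun_pair; apply: measurable_funD => //;
  exact: measurable_funM.
Qed.

(** Transposing, rotating both planes and transposing back preserves the doubled measure and sends
    [(v, u)] to [(u + v) / sqrt 2] and [(u - v) / sqrt 2]. Both points lie in [X] exactly when [u]
    is in [halves X v]. *)
Lemma gauss2_square (X : set plane) : measurable X ->
  (gauss2 X * gauss2 X = \int[gauss2]_v gauss2 (halves X v))%E.
Proof.
move=> mX; pose f (p : plane * plane) : \bar R := (\1_(X `*` X) p)%:E.
have mXX : measurable (X `*` X) by exact: measurableX.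
have mf : measurable_fun [set: plane * plane] f.
  by apply/measurable_EFinP; exact: measurable_indic.
have f0 p : (0 <= f p)%E by rewrite lee_fin.
pose f1 p := f (transpose4 p).
have mf1 : measurable_fun [set: plane * plane] f1.
  exact: measurableT_comp mf (@measurable_transpose4 _ line).
pose f2 p := f1 (rot c c p.1, rot c c p.2).
have mr := measurable_rot c c.
have mf2 : measurable_fun [set: plane * plane] f2.
  apply: (measurableT_comp mf1); apply: measurable_fun_pair.
    exact: (measurableT_comp mr measurable_fst).
  exact: (measurableT_comp mr measurable_snd).
have -> : (gauss2 X * gauss2 X = \int[gauss2 \x gauss2]_p f p)%E.
  rewrite integral_indic// setIT; exact/esym/product_measure1E.
have <- := @integral_transpose4 _ line R (@gauss1 R) f mf f0.
have <- := integral_rot2 mf1 (fun p => f0 _).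
have <- := @integral_transpose4 _ line R (@gauss1 R) f2 mf2 (fun p => f0 _).
have mf3 : measurable_fun [set: plane * plane] (f2 \o @transpose4 _ line).
  exact: measurableT_comp mf2 (@measurable_transpose4 _ line).
apply: (etrans (fubini_tonelli1 (m1 := gauss2) (m2 := gauss2) _ mf3 (fun p => f0 _))).
apply: eq_integral => v _.
transitivity (\int[gauss2]_u (\1_(halves X v) u)%:E)%E; last first.
  by rewrite integral_indic ?setIT//; exact: measurable_halves.
apply: eq_integral => u _; rewrite /f2 /f1 /f /transpose4 /rot /= !indicE.
by congr ((nat_of_bool _)%:R%:E); apply/idP/idP; rewrite !inE.
Qed.

End Doubling.

(** * Correlation of the sections of two symmetric relations *)

Section SectionCorrelation.
Context d (T : measurableType d) (R : realType) (P : probability T R).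
Implicit Types E : set (T * T).

Lemma measurable_prob_xsection E : measurable E ->
  measurable_fun [set: T] (fun v => P (xsection E v)).
Proof. exact: measurable_fun_xsection. Qed.

Lemma integral_indic_xsection (X : set T) E : measurable X -> measurable E ->
  (\int[P]_v ((\1_X v)%:E * P (xsection E v)) =
   \int[P]_w P (X `&` ysection E w))%E.
Proof.
move=> mX mE; pose f (p : T * T) : \bar R := (\1_((X `*` setT) `&` E) p)%:E.
have mXE : measurable ((X `*` setT) `&` E).
  by apply: measurableI => //; exact: measurableX.
have mf : measurable_fun [set: T * T] f.
  by apply/measurable_EFinP; exact: measurable_indic.
have f0 p : (0 <= f p)%E by rewrite lee_fin.
transitivity (\int[P]_v \int[P]_w f (v, w))%E.
  apply: eq_integral => v _.
  have mEv : measurable (xsection E v) by exact: measurable_xsection.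
  have -> : P (xsection E v) = (\int[P]_w (\1_(xsection E v) w)%:E)%E.
    by rewrite integral_indic// setIT.
  rewrite -ge0_integralZl//; last first.
    by apply/measurable_EFinP; exact: measurable_indic.
  apply: eq_integral => w _; rewrite /f !indicE -EFinM -natrM mulnb.
  congr ((nat_of_bool _)%:R%:E); apply/andP/idP; rewrite !inE xsectionE/=.
    by move=> [Xv Ew]; split.
  by move=> [[]].
rewrite (fubini_tonelli (m1 := P) (m2 := P) f mf f0).
apply: eq_integral => w _.
have mEw : measurable (ysection E w) by exact: measurable_ysection.
have mXw : measurable (X `&` ysection E w) by exact: measurableI.
transitivity (\int[P]_v (\1_(X `&` ysection E w) v)%:E)%E; last first.
  by rewrite integral_indic// setIT.
apply: eq_integral => v _; rewrite /f !indicE.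
congr ((nat_of_bool _)%:R%:E); apply/idP/idP; rewrite !inE ysectionE/=.
  by move=> [[]].
by move=> [].
Qed.

(* With E_v the section of E at v, symmetry turns the right-hand side into the
   integral of P (EA_u `&` EB_w) over u and w. *)
Lemma section_correlation (EA EB : set (T * T)) (q : R) : measurable EA ->
  measurable EB -> (forall v, xsection EA v = ysection EA v) ->
  (forall v, xsection EB v = ysection EB v) -> 0 <= q ->
  (forall u w, q%:E * (P (xsection EA u) * P (xsection EB w)) <=
               P (xsection EA u `&` xsection EB w))%E ->
  (q%:E * ((\int[P]_u P (xsection EA u)) * (\int[P]_w P (xsection EB w))) <=
   \int[P]_v (P (xsection EA v) * P (xsection EB v)))%E.
Proof.
move=> mA mB sA sB q0 qAB.
have mfA := measurable_prob_xsection mA; have mfB := measurable_prob_xsection mB.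
pose bB := (\int[P]_w P (xsection EB w))%E.
have bB0 : (0 <= bB)%E by exact: integral_ge0.
have mXA u : measurable (xsection EA u) by exact: measurable_xsection.
have mXB u : measurable (xsection EB u) by exact: measurable_xsection.
pose f (p : T * T) : \bar R := ((\1_EA p)%:E * P (xsection EB p.1))%E.
have mf : measurable_fun [set: T * T] f.
  apply: emeasurable_funM; first by apply/measurable_EFinP; exact: measurable_indic.
  exact: (measurableT_comp mfB measurable_fst).
have f0 p : (0 <= f p)%E by rewrite mule_ge0// lee_fin.
(* Write the first factor as an integral over [u] and exchange [u] with [v]. By symmetry of [EA] the
   inner integral then runs over its section at [u]; the same exchange is made for [EB] with [w]. *)
have -> : (\int[P]_v (P (xsection EA v) * P (xsection EB v)) =
    \int[P]_u fubini_G P f u)%E.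
  rewrite -(fubini_tonelli (m1 := P) (m2 := P) f mf f0).
  apply: eq_integral => v _.
  have -> : P (xsection EA v) = (\int[P]_u (\1_(xsection EA v) u)%:E)%E.
    by rewrite integral_indic// setIT.
  rewrite -ge0_integralZr//; last first.
    by apply/measurable_EFinP; exact: measurable_indic.
  apply: eq_integral => u _; rewrite /f/= !indicE; congr ((_)%:R%:E * _)%E.
  by congr nat_of_bool; apply/idP/idP; rewrite !inE xsectionE.
have inner u : (q%:E * P (xsection EA u) * bB <= fubini_G P f u)%E.
  have -> : fubini_G P f u =
      (\int[P]_v ((\1_(xsection EA u) v)%:E * P (xsection EB v)))%E.
    apply: eq_integral => v _; rewrite /f/= !indicE.
    congr ((nat_of_bool _)%:R%:E * _)%E.
    by rewrite sA; apply/idP/idP; rewrite !inE ysectionE.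
  rewrite integral_indic_xsection// /bB -ge0_integralZl//; last first.
    by rewrite mule_ge0// lee_fin.
  apply: ge0_le_integral => //.
  - by move=> w _; rewrite !mule_ge0// lee_fin.
  - exact: emeasurable_funM.
  - rewrite (_ : (fun w => _) = (fun w => P (ysection
      ((xsection EA u `*` setT) `&` EB) w))).
      apply: measurable_fun_ysection; apply: measurableI => //.
      exact: measurableX.
    apply/funext => w; congr (P _); rewrite !ysectionE; apply/seteqP.
    by split => v /=; [move=> [Xv Ev]|move=> [[Xv _] Ev]].
  - by move=> w _; rewrite -sB -muleA.
have -> : (q%:E * (\int[P]_u P (xsection EA u) * \int[P]_w P (xsection EB w)) =
    \int[P]_u (q%:E * P (xsection EA u) * bB))%E.
  have mq : measurable_fun [set: T] (fun u => q%:E * P (xsection EA u))%E.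
    exact: emeasurable_funM.
  rewrite [RHS]ge0_integralZr//; last by move=> u _; rewrite mule_ge0// lee_fin.
  by rewrite [in RHS]ge0_integralZl// muleA.
apply: ge0_le_integral => //.
- by move=> u _; rewrite !mule_ge0// lee_fin.
- by apply: emeasurable_funM => //; exact: emeasurable_funM.
- exact: (measurable_fun_fubini_tonelli_G (m1 := P) f mf f0).
Qed.

Lemma integral_xsection_ge (EA EB E : set (T * T)) (X : set T) (q k : R) :
  measurable EA -> measurable EB -> measurable E -> measurable X ->
  0 <= q -> 0 <= k ->
  (forall v, q%:E * (P (xsection EA v) * P (xsection EB v)) +
    k%:E * (\1_X v)%:E <= P (xsection E v))%E ->
  (q%:E * (\int[P]_v (P (xsection EA v) * P (xsection EB v))) + k%:E * P X <=
   \int[P]_v P (xsection E v))%E.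
Proof.
move=> mA mB mE mX q0 k0 le.
have mfA := measurable_prob_xsection mA; have mfB := measurable_prob_xsection mB.
have mAB := emeasurable_funM mfA mfB.
have m1 : measurable_fun [set: T]
    (fun v => q%:E * (P (xsection EA v) * P (xsection EB v)))%E.
  exact: (emeasurable_funM (measurable_cst _) mAB).
have m2 : measurable_fun [set: T] (fun v => k%:E * (\1_X v)%:E)%E.
  by apply: emeasurable_funM => //; apply/measurable_EFinP; exact: measurable_indic.
apply: (@le_trans _ _ (\int[P]_v (q%:E * (P (xsection EA v) *
    P (xsection EB v)) + k%:E * (\1_X v)%:E))%E).
  rewrite ge0_integralD//; last 2 first.
  - by move=> v _; rewrite !mule_ge0// lee_fin.
  - by move=> v _; rewrite mule_ge0// lee_fin.
  rewrite ge0_integralZl//; last by move=> v _; rewrite mule_ge0.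
  rewrite ge0_integralZl//; last by apply/measurable_EFinP; exact: measurable_indic.
  by rewrite integral_indic// setIT.
apply: ge0_le_integral => //.
- by move=> v _; rewrite adde_ge0// !mule_ge0// lee_fin.
- exact: emeasurable_funD.
- exact: measurable_prob_xsection.
Qed.

End SectionCorrelation.

(** * The gain from one doubling step *)

Section PolygonCorrelation.
Context {R : realType}.
Notation plane := (measurableTypeR R * measurableTypeR R)%type.
Notation gauss2 := (@gauss2 R).
Notation g2 := (prob gauss2).
Implicit Types (s : seq R) (h : R -> R) (v z : plane).

Let sqrt2 : R := Num.sqrt 2.

Let sqrt2_ge : 7 / 5 <= sqrt2.
Proof.
rewrite -[leLHS]ger0_norm; last by lra.
by rewrite -sqrtr_sqr; apply: ler_wsqrtr; lra.
Qed.

Lemma halves_polygon s h v :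
  halves (polygon s h) v = polygon s (fun t => sqrt2 * h t - `|v.1 + t * v.2|).
Proof.
have s0 : 0 < sqrt2 by rewrite (lt_le_trans _ sqrt2_ge).
have lin (k : R) u t : k * v.1 + sqrt2^-1 * u.1 + t * (k * v.2 + sqrt2^-1 * u.2)
    = k * (v.1 + t * v.2) + sqrt2^-1 * (u.1 + t * u.2).
  by move: u v => -[u1 u2] [v1 v2] /=;
    set x1 : R := u1; set x2 : R := u2; set y1 : R := v1; set y2 : R := v2; ring.
have norms (x y k : R) : (`|sqrt2^-1 * x + sqrt2^-1 * y| <= k /\
    `|- sqrt2^-1 * x + sqrt2^-1 * y| <= k) <-> `|y| <= sqrt2 * k - `|x|.
  rewrite mulNr -mulrN -!mulrDr !normrM (gtr0_norm (_ : 0 < sqrt2^-1)) ?invr_gt0//.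
  rewrite ![sqrt2^-1 * _]mulrC !ler_pdivrMr// [k * _]mulrC.
  rewrite lerBrDl !ler_norml; move: (sqrt2 * k) => K.
  split=> [[h1 h2]|h1].
    by case: (ger0P x) => ?; case: (ger0P y) => ?; lra.
  by move: h1; case: (ger0P x) => ?; case: (ger0P y) => ? ?; split; lra.
apply/seteqP; split => [u [uP uP'] t ts|u uP].
  by apply/norms; split; [have := uP t ts|have := uP' t ts]; rewrite /= lin.
by split=> t ts; have /norms[] := uP t ts; rewrite /= lin.
Qed.

Definition halves_graph (X : set plane) : set (plane * plane) :=
  [set p | halves X p.1 p.2].

Lemma measurable_halves_graph X : measurable X -> measurable (halves_graph X).
Proof.
move=> mX; have m1 : measurable_fun [set: plane * plane] (fun p => p.1.1).
  exact: (measurableT_comp measurable_fst measurable_fst).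
have m2 : measurable_fun [set: plane * plane] (fun p => p.1.2).
  exact: (measurableT_comp measurable_snd measurable_fst).
have m3 : measurable_fun [set: plane * plane] (fun p => p.2.1).
  exact: (measurableT_comp measurable_fst measurable_snd).
have m4 : measurable_fun [set: plane * plane] (fun p => p.2.2).
  exact: (measurableT_comp measurable_snd measurable_snd).
by apply: measurableI; apply: (measurable_preimageT _ mX);
  apply: measurable_fun_pair; apply: measurable_funD => //; exact: measurable_funM.
Qed.

Lemma xsection_halves_graph X v : xsection (halves_graph X) v = halves X v.
Proof. by rewrite xsectionE. Qed.

(** By [halves_polygon] the relation reads [|u.1 + t * u.2| + |v.1 + t * v.2| <= sqrt2 * h t], which
    is symmetric in [u] and [v]. *)
Lemma ysection_halves_graph s h v :
  ysection (halves_graph (polygon s h)) v = halves (polygon s h) v.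
Proof.
rewrite ysectionE; apply/seteqP; split => u.
  rewrite /halves_graph /= !halves_polygon => uP t ts.
  by have := uP t ts; rewrite !lerBrDl addrC.
rewrite /halves_graph /= !halves_polygon => uP t ts.
by have := uP t ts; rewrite !lerBrDl addrC.
Qed.

Lemma halvesI X Y v : halves (X `&` Y) v = halves X v `&` halves Y v.
Proof. by apply/seteqP; split=> u [[? ?] [? ?]]; do 2 split. Qed.

Lemma g2_square X : measurable X ->
  (\int[gauss2]_v gauss2 (xsection (halves_graph X) v) = (g2 X * g2 X)%:E)%E.
Proof.
move=> mX; have := gauss2_square mX; rewrite (probE gauss2 mX) -EFinM => ->.
by apply: eq_integral => v _; rewrite xsection_halves_graph.
Qed.

(** One factor [q] comes from correlating the sections at each [v], the other from
    [section_correlation] after integration. For [v] in the box of width [r / 5] the bound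
    [sqrt2 >= 7 / 5] leaves at least 6/5 of each width: there [q'] may replace [q], and the sections
    weigh no less than the polygons. *)
Lemma doubling_gain s (q q' r : R) (h h' : R -> R) : 0 <= q -> q <= q' -> 0 < r ->
  (forall h h', q * (g2 (polygon s h) * g2 (polygon s h')) <=
                g2 (polygon s h `&` polygon s h')) ->
  (forall h h', (forall t, t \in s -> 6 / 5 * r <= h t /\ 6 / 5 * r <= h' t) ->
     q' * (g2 (polygon s h) * g2 (polygon s h')) <=
     g2 (polygon s h `&` polygon s h')) ->
  (forall t, t \in s -> r <= h t /\ r <= h' t) ->
  (q ^+ 2 + (q' - q) * g2 (polygon s (fun=> r / 5))) *
    (g2 (polygon s h) * g2 (polygon s h')) ^+ 2 <=
  g2 (polygon s h `&` polygon s h') ^+ 2.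
Proof.
move=> q0 qq' r0 all big hr.
set A := polygon s h; set B := polygon s h'; set Box := polygon s _.
have mA : measurable A by exact: measurable_polygon.
have mB : measurable B by exact: measurable_polygon.
have mAB : measurable (A `&` B) by exact: measurableI.
have mBox : measurable Box by exact: measurable_polygon.
pose EA := halves_graph A; pose EB := halves_graph B.
have mEA : measurable EA by exact: measurable_halves_graph.
have mEB : measurable EB by exact: measurable_halves_graph.
pose a := g2 A; pose b := g2 B; pose k := (q' - q) * (a * b).
have a0 : 0 <= a := prob_nneg _ _; have b0 : 0 <= b := prob_nneg _ _.
have a1 : a <= 1 := prob_leone _ mA; have b1 : b <= 1 := prob_leone _ mB.
have k0 : 0 <= k by rewrite mulr_ge0 ?subr_ge0 ?mulr_ge0.
have mXA v : measurable (xsection EA v) by exact: measurable_xsection.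
have mXB v : measurable (xsection EB v) by exact: measurable_xsection.
have XA v : xsection EA v = polygon s (fun t => sqrt2 * h t - `|v.1 + t * v.2|).
  by rewrite xsection_halves_graph halves_polygon.
have XB v : xsection EB v = polygon s (fun t => sqrt2 * h' t - `|v.1 + t * v.2|).
  by rewrite xsection_halves_graph halves_polygon.
have mfA : measurable_fun [set: plane] (fun v => gauss2 (xsection EA v)).
  exact: measurable_prob_xsection.
have mfB : measurable_fun [set: plane] (fun v => gauss2 (xsection EB v)).
  exact: measurable_prob_xsection.
have indep : (q%:E * (a * a * (b * b))%:E <=
    \int[gauss2]_v (gauss2 (xsection EA v) * gauss2 (xsection EB v)))%E.
  rewrite EFinM -(g2_square mA) -(g2_square mB).
  apply: section_correlation => // [v|v|u w].
  - by rewrite xsection_halves_graph ysection_halves_graph.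
  - by rewrite xsection_halves_graph ysection_halves_graph.
  - have mI := measurableI _ _ (mXA u) (mXB w).
    rewrite (probE _ (mXA u)) (probE _ (mXB w)) (probE _ mI) -!EFinM lee_fin.
    by rewrite XA XB; exact: all.
have pointwise v : (q%:E * (gauss2 (xsection EA v) * gauss2 (xsection EB v)) +
    k%:E * (\1_Box v)%:E <= gauss2 (xsection EA v `&` xsection EB v))%E.
  have mI := measurableI _ _ (mXA v) (mXB v).
  rewrite (probE _ (mXA v)) (probE _ (mXB v)) (probE _ mI) -!EFinM -EFinD lee_fin.
  rewrite indicE; have [|_] := boolP (v \in Box); last first.
    by rewrite mulr0 addr0 XA XB; exact: all.
  rewrite inE mulr1 => vBox.
  have wide t : t \in s -> h t <= sqrt2 * h t - `|v.1 + t * v.2| /\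
      h' t <= sqrt2 * h' t - `|v.1 + t * v.2| /\
      6 / 5 * r <= sqrt2 * h t - `|v.1 + t * v.2| /\
      6 / 5 * r <= sqrt2 * h' t - `|v.1 + t * v.2|.
    move=> ts; have vt := vBox t ts; have [ht h't] := hr t ts.
    have : 7 / 5 * h t <= sqrt2 * h t by rewrite ler_wpM2r// ltW// (lt_le_trans r0).
    have : 7 / 5 * h' t <= sqrt2 * h' t by rewrite ler_wpM2r// ltW// (lt_le_trans r0).
    move: vt ht h't; move: `|_| (sqrt2 * h t) (sqrt2 * h' t) => x y z.
    lra.
  have aX : a <= g2 (xsection EA v).
    apply: prob_mono => //; rewrite XA => z zA t ts.
    by apply: (le_trans (zA t ts)); case: (wide t ts).
  have bX : b <= g2 (xsection EB v).
    apply: prob_mono => //; rewrite XB => z zB t ts.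
    by apply: (le_trans (zB t ts)); case: (wide t ts) => _ [].
  have := big (fun t => sqrt2 * h t - `|v.1 + t * v.2|)
              (fun t => sqrt2 * h' t - `|v.1 + t * v.2|).
  rewrite -XA -XB => /(_ (fun t ts => proj2 (proj2 (wide t ts)))).
  apply: le_trans; rewrite -[q' in leRHS](subrK q) [leRHS]mulrDl [leRHS]addrC.
  by rewrite lerD2l ler_wpM2l ?subr_ge0// ler_pM.
have mE := measurable_halves_graph mAB.
have pw v : (q%:E * (gauss2 (xsection EA v) * gauss2 (xsection EB v)) +
    k%:E * (\1_Box v)%:E <= gauss2 (xsection (halves_graph (A `&` B)) v))%E.
  by apply: (le_trans (pointwise v)); rewrite !xsection_halves_graph halvesI.
have main := integral_xsection_ge mEA mEB mE mBox q0 k0 pw.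
have {main} := eq_ind _ (fun x => (_ <= x)%E) main _ (g2_square mAB).
move=> /(le_trans _) main.
have {main} : (q%:E * (q%:E * (a * a * (b * b))%:E) + k%:E * (g2 Box)%:E <=
    (g2 (A `&` B) * g2 (A `&` B))%:E)%E.
  apply: main; rewrite (probE _ mBox); apply: leeD => //.
  by apply: lee_wpmul2l => //; rewrite lee_fin.
rewrite -!EFinM -EFinD lee_fin -expr2 -/a -/b.
apply: le_trans; rewrite mulrDl lerD//.
  by rewrite le_eqVlt; apply/orP; left; apply/eqP; ring.
rewrite /k [leRHS]mulrAC ler_wpM2l// ?mulr_ge0 ?subr_ge0 ?prob_nneg//.
(* The gain carries only the first power of [a * b]; being at most 1, this dominates the square. *)
by rewrite expr2 ler_piMr ?mulr_ge0// mulr_ile1.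
Qed.

End PolygonCorrelation.

(** * The correlation inequality for polygons *)

Section PolygonGCI.
Context {R : realType}.
Notation plane := (measurableTypeR R * measurableTypeR R)%type.
Notation gauss2 := (@gauss2 R).
Notation g2 := (prob gauss2).
Implicit Types (s : seq R) (h : R -> R) (z : plane).

(** By strip correlation, each new slope multiplies the mass by at least a positive strip mass. *)
Lemma g2_polygon_gt0 s (a : R) : 0 < a -> 0 < g2 (polygon s (fun=> a)).
Proof.
move=> a0; elim: s => [|t s IH].
  rewrite (_ : polygon [::] _ = [set: plane]); last by apply/seteqP; split.
  have := probE gauss2 (@measurableT _ plane).
  by rewrite (probability_setT gauss2) => e; rewrite -(EFin_inj e).
rewrite polygon_cons.
apply: lt_le_trans (g2_strip_correlation t (ltW a0) (measurable_polygon s _)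
  (@convex2_polygon R s _) (@symmetric2_polygon R s _)).
rewrite mulr_gt0//; have [c c0 cP] := g2_strip_ge t.
apply: (@lt_le_trans _ _ (c * Num.min a 1)); first by rewrite mulr_gt0// lt_min a0/=.
apply: (@le_trans _ _ (g2 (strip t (Num.min a 1)))).
  by apply: cP; rewrite le_min (ltW a0) ler01 ge_min lexx orbT.
apply: prob_mono; [exact: measurable_strip..|].
by move=> z /= /le_trans; apply; rewrite ge_min lexx.
Qed.

Lemma g2_large_polygon s (q : R) : q < 1 ->
  exists2 M : R, 0 < M & q <= g2 (polygon s (fun=> M)).
Proof.
move=> q1; pose F (n : nat) : set plane := polygon s (fun=> n.+1%:R).
have mF n : measurable (F n) by exact: measurable_polygon.
have FU : \bigcup_n F n = [set: plane].
  apply/seteqP; split => // z _.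
  have [K K1 KP] := @seq_uniform_bound R _ s (fun t K => `|z.1 + t * z.2| <= K)
    (fun t K K' zK KK' => le_trans zK KK') (fun t _ => ex_intro _ `|z.1 + t * z.2| (lexx _)).
  exists (Num.truncn K) => // t ts; apply: (le_trans (KP t ts)).
  by rewrite ltW// truncnS_gt.
have ndF : nondecreasing_seq F.
  move=> m n mn; apply/subsetPset => z zF t ts; apply: (le_trans (zF t ts)).
  by rewrite ler_nat.
have cvgF : gauss2 (F n) @[n --> \oo] --> 1%E.
  rewrite -(probability_setT gauss2) -FU; apply: nondecreasing_cvg_mu => //.
  by rewrite FU.
apply: contrapT => small; move: q1; apply/negP; rewrite -leNgt -lee_fin.
apply: (cvge_le _ cvgF); apply: nearW => n; rewrite (probE _ (mF n)) lee_fin.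
by rewrite leNgt; apply/negP => qn; apply: small; exists n.+1%:R => //; exact: ltW.
Qed.

Lemma exp_unbounded (M : R) : exists k : nat, M <= (6 / 5) ^+ k.
Proof.
have bern (k : nat) : k%:R / 5 <= (6 / 5 : R) ^+ k.
  elim: k => [|k IH]; first by rewrite expr0 mul0r ler01.
  have one : 1 <= (6 / 5 : R) ^+ k by apply: exprn_ege1; lra.
  rewrite exprS -natr1; move: IH one; move: (_ ^+ k) k%:R => x y; lra.
exists (Num.truncn (5 * M)).+1; apply: le_trans (bern _).
rewrite ler_pdivlMr; last by lra.
by rewrite mulrC ltW// truncnS_gt.
Qed.

Section Improvement.
Variables (s : seq R) (q : R).
Hypotheses (q0 : 0 <= q) (q1 : q < 1).
Hypothesis allq : forall h h', q * (g2 (polygon s h) * g2 (polygon s h')) <=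
  g2 (polygon s h `&` polygon s h').

Let good_above (r q' : R) := forall h h', (forall t, t \in s -> r <= h t /\ r <= h' t) ->
  q' * (g2 (polygon s h) * g2 (polygon s h')) <= g2 (polygon s h `&` polygon s h').

Let good_step (r q' : R) : 0 < r -> q < q' -> good_above (6 / 5 * r) q' ->
  exists2 q'', q < q'' & good_above r q''.
Proof.
move=> r0 qq' good; pose b := g2 (polygon s (fun=> r / 5)).
have b0 : 0 < b by apply: g2_polygon_gt0; rewrite divr_gt0.
pose Q := q ^+ 2 + (q' - q) * b.
have qQ : q ^+ 2 < Q by rewrite ltrDl mulr_gt0// subr_gt0.
have Q0 : 0 <= Q by apply: ltW; apply: le_lt_trans qQ; rewrite sqr_ge0.
(* [doubling_gain] compares squares, and [Q] exceeds [q ^+ 2]. *)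
exists (Num.sqrt Q).
  rewrite -(ger0_norm q0) -sqrtr_sqr ltr_sqrt//.
  by apply: le_lt_trans qQ; rewrite sqr_ge0.
move=> h h' hr; have := doubling_gain q0 (ltW qq') r0 allq good hr.
rewrite -/b -/Q => main.
have n0 X : 0 <= g2 X by exact: prob_nneg.
rewrite -(@ler_pXn2r _ 2)// ?nnegrE ?n0// ?mulr_ge0 ?sqrtr_ge0//.
by rewrite exprMn sqr_sqrtr.
Qed.

Let good_descent (k : nat) (r q' : R) : 0 < r -> q < q' ->
  good_above ((6 / 5) ^+ k * r) q' -> exists2 q'', q < q'' & good_above r q''.
Proof.
elim: k r q' => [|k IH] r q' r0 qq' good.
  by exists q' => //; move: good; rewrite expr0 mul1r.
have r'0 : 0 < 6 / 5 * r by rewrite mulr_gt0//; lra.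
have [|q2 qq2 good2] := IH (6 / 5 * r) q' r'0 qq'.
  by rewrite mulrA -exprSr.
exact: good_step good2.
Qed.

(** Widths at least [M] are settled because the intersection alone has mass [1 - e], a width below
    [r] by [thin_polygons]. The range between is bridged by [k] doubling steps, a number depending
    on [M / r] only. *)
Lemma polygon_improvement : (forall i, i \in s -> exists2 j, j \in s & j != i) ->
  exists2 q', q < q' <= 1 &
    forall h h', q' * (g2 (polygon s h) * g2 (polygon s h')) <=
      g2 (polygon s h `&` polygon s h').
Proof.
(* This puts [1 - e] strictly between [q] and 1. *)
move=> other; pose e := (1 - q) / 2.
have e01 : 0 < e <= 1.
  by move: q0 q1; rewrite /e => ? ?; apply/andP; split; lra.
have [r r0 thin] := thin_polygons e01 other.
have eq1 : 1 - e < 1 by move: e01; lra.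
have [M M0 qM] := g2_large_polygon s eq1.
have goodM : good_above M (1 - e).
  move=> h h' hM.
  have gg1 : g2 (polygon s h) * g2 (polygon s h') <= 1.
    by rewrite mulr_ile1 ?prob_nneg ?prob_leone//; exact: measurable_polygon.
  apply: (@le_trans _ _ (1 - e)); first by rewrite ler_piMr//; move: e01; lra.
  apply: (le_trans qM); apply: prob_mono; first exact: measurable_polygon.
    by apply: measurableI; exact: measurable_polygon.
  by move=> z zM; split=> t ts; apply: (le_trans (zM t ts)); case: (hM t ts).
have [k kP] := exp_unbounded (M / r).
have Mk : M <= (6 / 5) ^+ k * r by rewrite -ler_pdivrMr.
have qe : q < 1 - e by move: q1; rewrite /e => ?; lra.
have [|q2 qq2 good2] := @good_descent k r (1 - e) r0 qe.
  by move=> h h' hM; apply: goodM => t /hM[h1 h2]; split; exact: le_trans Mk _.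
exists (Num.min q2 (1 - e)).
  by rewrite lt_min qq2 qe/= ge_min (ltW eq1) orbT.
move=> h h'.
have gg0 : 0 <= g2 (polygon s h) * g2 (polygon s h').
  by rewrite mulr_ge0 ?prob_nneg.
have [small|large] := pselect (exists2 t, t \in s & (h t < r) || (h' t < r)).
  by apply: le_trans (thin h h' small); rewrite ler_wpM2r// ge_min lexx orbT.
apply: (@le_trans _ _ (q2 * (g2 (polygon s h) * g2 (polygon s h')))).
  by rewrite ler_wpM2r// ge_min lexx.
apply: good2 => t ts; split; rewrite leNgt; apply/negP => ht; apply: large;
  by exists t; rewrite // ht ?orbT.
Qed.

End Improvement.

Lemma polygon_correlation s h h' :
  (forall i, i \in s -> exists2 j, j \in s & j != i) ->
  g2 (polygon s h) * g2 (polygon s h') <= g2 (polygon s h `&` polygon s h').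
Proof.
move=> other.
pose S := [set q : R | 0 <= q <= 1 /\ forall h h',
  q * (g2 (polygon s h) * g2 (polygon s h')) <= g2 (polygon s h `&` polygon s h')].
have S0 : S 0 by split; [rewrite lexx ler01|move=> *; rewrite mul0r prob_nneg].
have S1 : ubound S 1 by move=> q [/andP[_ q1] _].
have supS : has_sup S by split; [exists 0|exists 1].
have q0 : 0 <= sup S by exact: sup_upper_bound supS _ S0.
have q1 : sup S <= 1 by apply: ge_sup => //; exists 0.
(* For fixed polygons the inequality is closed in the constant, so the supremum is itself
   admissible. *)
have allq h1 h2 : sup S * (g2 (polygon s h1) * g2 (polygon s h2)) <=
    g2 (polygon s h1 `&` polygon s h2).
  have [x0|x0] := leP (g2 (polygon s h1) * g2 (polygon s h2)) 0.
    by apply: le_trans (prob_nneg _ _); rewrite mulr_ge0_le0.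
  rewrite -ler_pdivlMr//; apply: ge_sup; first by exists 0.
  by move=> q [_ qP]; rewrite ler_pdivlMr//; exact: qP.
have [sup1|sup1] := ltP (sup S) 1; last first.
  by have := allq h h'; rewrite (_ : sup S = 1) ?mul1r//; apply: le_anti; rewrite q1 sup1.
have [q' /andP[qq' q'1] q'P] := polygon_improvement q0 sup1 allq other.
have : q' <= sup S.
  apply: (sup_upper_bound supS); split => //.
  by rewrite q'1 (le_trans q0 (ltW qq')).
by rewrite leNgt qq'.
Qed.

End PolygonGCI.

(** * Separating a point from a convex body by a rational slope *)

Section ConvexBodies.
Context {R : realType}.
Implicit Types K : set (R * R).

Let fst_continuous : continuous (fst : R * R -> R). Proof. by move=> z; exact: cvg_fst. Qed.
Let snd_continuous : continuous (snd : R * R -> R). Proof. by move=> z; exact: cvg_snd. Qed.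

Lemma compact2_bounded K : compact K ->
  exists M : R, forall z, K z -> `|z.1| <= M /\ `|z.2| <= M.
Proof.
move=> cK; have bounded (f : R * R -> R) : continuous f ->
    exists M, forall z, K z -> `|f z| <= M.
  move=> contf; have [|M [_ MP]] := @compact_bounded R R^o (f @` K).
    by apply: continuous_compact => //; exact: continuous_subspaceT.
  by exists (M + 1) => z Kz; apply: (MP (M + 1)); [rewrite ltrDl|exists z].
have [M1 M1P] := bounded _ fst_continuous.
have [M2 M2P] := bounded _ snd_continuous.
exists (Num.max M1 M2) => z Kz.
by rewrite !le_max M1P// M2P// orbT.
Qed.

Lemma closest_point K (z : R * R) : compact K -> K !=set0 ->
  exists2 p, K p & forall x, K x ->
    (z.1 - p.1) ^+ 2 + (z.2 - p.2) ^+ 2 <= (z.1 - x.1) ^+ 2 + (z.2 - x.2) ^+ 2.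
Proof.
move=> cK K0.
pose f (x : R * R) : R := (z.1 - x.1) ^+ 2 + (z.2 - x.2) ^+ 2.
have contsq (g : R * R -> R) (a : R) : continuous g ->
    continuous (fun x => (a - g x) ^+ 2).
  move=> contg x.
  apply: (@continuous_comp _ _ _ (fun x => a - g x) (fun y : R => y ^+ 2)).
    by apply: (@continuousB _ R^o); [exact: cst_continuous|exact: contg].
  exact: exprn_continuous.
have contf : continuous f.
  by move=> x; apply: (@cvgD _ R^o); apply: contsq.
have [p pK pmin] := compact_EVT_min K0 cK (continuous_subspaceT contf).
by exists p => [|x Kx]; [exact: set_mem|apply: pmin; exact: mem_set].
Qed.

Lemma closest_point_separates K (z p : R * R) : convex2 K -> K p ->
  (forall x, K x ->
    (z.1 - p.1) ^+ 2 + (z.2 - p.2) ^+ 2 <= (z.1 - x.1) ^+ 2 + (z.2 - x.2) ^+ 2) ->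
  forall x, K x ->
    (x.1 - p.1) * (z.1 - p.1) + (x.2 - p.2) * (z.2 - p.2) <= 0.
Proof.
move=> cK Kp pmin x Kx; rewrite leNgt; apply/negP.
set D := _ + _ => D0; pose E := (x.1 - p.1) ^+ 2 + (x.2 - p.2) ^+ 2.
have E0 : 0 <= E by rewrite addr_ge0 ?sqr_ge0.
have DE : 0 < D + E by rewrite ltr_pwDl.
(* Moving from [p] towards [x] by the fraction [t] changes the squared distance by
   [- 2 t D + t ^ 2 E], which is negative here; adding [D] to the denominator keeps [t] at most
   1. *)
pose t := D / (D + E).
have t0 : 0 < t by rewrite divr_gt0.
have tDE : t * (D + E) = D by rewrite divfK// gt_eqF.
have t1 : t <= 1 by rewrite ler_pdivrMr// mul1r lerDl.
have t01 : 0 <= t <= 1 by rewrite (ltW t0) t1.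
have := pmin _ (cK _ _ Kx Kp t t01); rewrite /=.
have tD0 : 0 < t * D by rewrite mulr_gt0.
have ttD0 : 0 <= t * (t * D) by rewrite mulr_ge0// ltW.
have ttE : t * (t * E) = t * (D - t * D).
  by congr (t * _); move: tDE; rewrite mulrDr; lra.
rewrite [leRHS](_ : _ = (z.1 - p.1) ^+ 2 + (z.2 - p.2) ^+ 2 - 2 * (t * D) + t * (t * E)).
  by move: ((z.1 - p.1) ^+ 2 + (z.2 - p.2) ^+ 2) => w; rewrite ttE mulrBr; lra.
by rewrite /D /E; ring.
Qed.

(** The closest point gives a normal [(w1, w2)] with margin [W]. On bounded sets a small
    perturbation to a rational slope keeps half of it, and symmetry of [K] turns the one-sided bound
    into one on absolute values. *)
Lemma rational_separation K (z : R * R) : compact K -> convex2 K ->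
  centrally_symmetric2 K -> K !=set0 -> ~ K z ->
  exists q : rat, exists2 d, 0 < d & forall x, K x ->
    `|x.1 + ratr q * x.2| <= `|z.1 + ratr q * z.2| - d.
Proof.
move=> cK convK symK K0 Kz.
have [p Kp pmin] := closest_point z cK K0.
have sep := closest_point_separates convK Kp pmin.
pose w1 := z.1 - p.1; pose w2 := z.2 - p.2; pose W := w1 ^+ 2 + w2 ^+ 2.
have W0 : 0 < W.
  rewrite lt_neqAle addr_ge0 ?sqr_ge0// andbT eq_sym paddr_eq0 ?sqr_ge0//.
  rewrite !sqrf_eq0 !subr_eq0; apply/negP => /andP[/eqP e1 /eqP e2]; apply: Kz.
  by rewrite (surjective_pairing z) e1 e2 -surjective_pairing.
have half x : K x -> x.1 * w1 + x.2 * w2 <= z.1 * w1 + z.2 * w2 - W.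
  move=> /sep; rewrite -/w1 -/w2 /W.
  have e1 : z.1 * w1 = p.1 * w1 + w1 ^+ 2 by rewrite /w1; ring.
  have e2 : z.2 * w2 = p.2 * w2 + w2 ^+ 2 by rewrite /w2; ring.
  by rewrite e1 e2 !mulrBl; lra.
have [M0 M0P] := compact2_bounded cK.
pose N := Num.max M0 (Num.max `|z.1| `|z.2|); pose M := N + 1.
have NM : N <= M by rewrite lerDl.
have MK x : K x -> `|x.1| <= M /\ `|x.2| <= M.
  have M0N : M0 <= N by rewrite le_max lexx.
  by move=> /M0P[h1 h2]; split; apply: le_trans NM; exact: le_trans M0N.
have Mz : `|z.1| <= M /\ `|z.2| <= M.
  by split; apply: le_trans NM; rewrite !le_max lexx !orbT.
have M_gt0 : 0 < M by rewrite ltr_wpDl// !le_max normr_ge0 orbT.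
(* Changing both coordinates of the normal by at most [e] moves the form by at most [2 M e = W / 4],
   at [z] and on [K] alike, so [W / 2] remains. *)
pose e := W / (8 * M).
have e0 : 0 < e by rewrite divr_gt0// mulr_gt0.
have eM : e * M = W / 8 by rewrite /e; field; rewrite gt_eqF.
(* A normal [(0, w2)] has no slope and is tilted first. *)
pose v1 := if w1 == 0 then e else w1.
have v10 : v1 != 0 by rewrite /v1; case: ifPn => // _; rewrite gt_eqF.
have v1w : `|v1 - w1| <= e.
  rewrite /v1; case: ifPn => [/eqP->|_]; first by rewrite subr0 gtr0_norm.
  by rewrite subrr normr0 ltW.
have nv1 : 0 < `|v1| by rewrite normr_gt0.
have [q] : exists q : rat, ratr q \in `]w2 / v1 - e / `|v1|, w2 / v1 + e / `|v1|[.
  by apply: rat_in_itvoo; rewrite ltrD2l gt0_cp// divr_gt0.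
rewrite in_itv/= -ltr_distl => qP.
pose v2 := ratr q * v1.
have v2w : `|v2 - w2| <= e.
  rewrite (_ : v2 - w2 = (ratr q - w2 / v1) * v1); last by rewrite mulrBl divfK.
  by rewrite normrM -ler_pdivlMr// ltW.
have close (x : R * R) : `|x.1| <= M /\ `|x.2| <= M ->
    `|(x.1 * v1 + x.2 * v2) - (x.1 * w1 + x.2 * w2)| <= W / 4.
  move=> [x1 x2].
  rewrite (_ : _ - _ = x.1 * (v1 - w1) + x.2 * (v2 - w2)); last by ring.
  apply: (le_trans (ler_normD _ _)); rewrite !normrM.
  apply: (@le_trans _ _ (M * e + M * e)); first by apply: lerD; apply: ler_pM.
  by rewrite [M * e]mulrC eM; lra.
exists q; exists (W / 2 / `|v1|); first by rewrite !divr_gt0.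
move=> x Kx; rewrite -(ler_pM2r nv1) mulrBl divfK ?gt_eqF// -!normrM.
have lin (y : R * R) : (y.1 + ratr q * y.2) * v1 = y.1 * v1 + y.2 * v2.
  by rewrite /v2; move: y => [y1 y2] /=; set a : R := y1; set b : R := y2; ring.
rewrite !lin.
have bound y : K y -> y.1 * v1 + y.2 * v2 <= z.1 * v1 + z.2 * v2 - W / 2.
  move=> Ky; have := half y Ky.
  have := close y (MK y Ky); have := close z Mz; rewrite !ler_norml.
  by move=> /andP[h1 h2] /andP[h3 h4]; lra.
apply: (@le_trans _ _ (z.1 * v1 + z.2 * v2 - W / 2)); last first.
  by rewrite lerD2r ler_norm.
have := bound _ Kx; have := bound _ (symK _ Kx); rewrite /= !mulNr ler_norml.
by move=> h1 h2; lra.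
Qed.

End ConvexBodies.

(** * From polygons to symmetric convex bodies *)

Section BodyCorrelation.
Context {R : realType}.
Notation plane := (measurableTypeR R * measurableTypeR R)%type.
Notation gauss2 := (@gauss2 R).
Notation g2 := (prob gauss2).
Implicit Types K : set (R * R).

Definition support K (t : R) : R := sup [set `|x.1 + t * x.2| | x in K].

Definition rational (n : nat) : R := ratr (odflt 0%Q (unpickle n)).

(** The entries 0 and 1 provide two distinct slopes at every stage, as [polygon_correlation]
    requires. *)
Definition slopes (N : nat) : seq R := 0 :: 1 :: [seq rational n | n <- iota 0 N].

Definition circumscribed K (N : nat) : set plane := polygon (slopes N) (support K).

Lemma slopes_other N i : i \in slopes N -> exists2 j, j \in slopes N & j != i.
Proof.
move=> _; have [->|i0] := eqVneq i 0.
  by exists 1; rewrite ?oner_neq0// !inE eqxx orbT.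
by exists 0; rewrite 1?eq_sym// inE eqxx.
Qed.

Lemma slopes_mono m n : (m <= n)%N -> {subset slopes m <= slopes n}.
Proof.
move=> mn t; rewrite !inE => /or3P[->//|->|]; rewrite ?orbT//.
move=> /mapP[k]; rewrite mem_iota add0n => /andP[_ km] ->.
by apply/or3P/Or33/map_f; rewrite mem_iota add0n (leq_trans km).
Qed.

Lemma circumscribed_noninc K : nonincreasing_seq (circumscribed K).
Proof.
by move=> m n mn; apply/subsetPset => z zP t ts; apply: zP; exact: slopes_mono ts.
Qed.

Lemma bigcap_circumscribed K : compact K -> convex2 K ->
  centrally_symmetric2 K -> K !=set0 -> \bigcap_N circumscribed K N = K.
Proof.
move=> cK convK symK K0.
have [M MP] := compact2_bounded cK.
have supK t : has_sup [set `|x.1 + t * x.2| | x in K].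
  split; first by case: K0 => x Kx; exists `|x.1 + t * x.2|; exists x.
  exists (M + `|t| * M) => _ [x Kx <-]; have [x1 x2] := MP x Kx.
  by apply: (le_trans (ler_normD _ _)); rewrite normrM lerD// ler_wpM2l.
apply/seteqP; split => [z zP|z Kz N _ t _]; last first.
  by apply: sup_upper_bound => //; exists z.
apply: contrapT => Kz.
have [q [d d0 qP]] := rational_separation cK convK symK K0 Kz.
have qs : ratr q \in slopes (pickle q).+1.
  rewrite 2!in_cons; apply/or3P/Or33; apply/mapP; exists (pickle q).
    by rewrite mem_iota add0n ltnSn.
  by rewrite /rational pickleK.
have := zP (pickle q).+1 I _ qs.
have : support K (ratr q) <= `|z.1 + ratr q * z.2| - d.
  by apply: ge_sup => [|_ [x Kx <-]]; [case: (supK (ratr q))|exact: qP].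
by lra.
Qed.

Lemma measurable_circumscribed K N : measurable (circumscribed K N).
Proof. exact: measurable_polygon. Qed.

Lemma measurable_symmetric_body K : compact K -> convex2 K ->
  centrally_symmetric2 K -> measurable (K : set plane).
Proof.
move=> cK convK symK; have [->|/set0P K0] := eqVneq K set0; first exact: measurable0.
rewrite -(bigcap_circumscribed cK convK symK K0).
by apply: bigcapT_measurable => N; exact: measurable_circumscribed.
Qed.

(** Replacing the bodies by circumscribed polygons only increases the left side; the intersections
    of these polygons decrease to the intersection of the bodies, and continuity from above
    applies. *)
Theorem gaussian_correlation K K' : compact K -> convex2 K ->
  centrally_symmetric2 K -> K !=set0 -> compact K' -> convex2 K' ->
  centrally_symmetric2 K' -> K' !=set0 -> g2 K * g2 K' <= g2 (K `&` K').
Proof.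
move=> cK convK symK K0 cK' convK' symK' K'0.
have mK := measurable_symmetric_body cK convK symK.
have mK' := measurable_symmetric_body cK' convK' symK'.
have mI : measurable (K `&` K' : set plane) by exact: measurableI.
pose F N := circumscribed K N `&` circumscribed K' N.
have mF N : measurable (F N).
  by apply: measurableI; exact: measurable_circumscribed.
have FE : \bigcap_N F N = K `&` K'.
  by rewrite bigcapI !bigcap_circumscribed.
have cvgF : gauss2 (F N) @[N --> \oo] --> gauss2 (K `&` K').
  rewrite -FE; apply: nonincreasing_cvg_mu => //.
  - by rewrite (le_lt_trans (probability_le1 _ _))// ltry.
  - by rewrite FE.
  - move=> m n mn; apply/subsetPset.
    by apply: setISS; apply/subsetPset; exact: circumscribed_noninc.
rewrite -lee_fin -(probE gauss2 mI).
apply: (cvge_ge _ cvgF); apply: nearW => N; rewrite (probE gauss2 (mF N)) lee_fin.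
apply: le_trans (polygon_correlation _ _ (@slopes_other N)).
have sub L : compact L -> convex2 L -> centrally_symmetric2 L -> L !=set0 ->
    L `<=` circumscribed L N.
  by move=> cL convL symL L0; rewrite -{1}(bigcap_circumscribed cL convL symL L0);
    exact: bigcap_inf.
apply: ler_pM; rewrite ?prob_nneg//; apply: prob_mono; rewrite ?mK ?mK'//;
  by [exact: measurable_circumscribed|exact: sub].
Qed.

End BodyCorrelation.

(** * The weighted measure without its constant *)

Section WeightedMeasure.
Context {R : realType}.
Notation line := (measurableTypeR R).
Notation plane := (measurableTypeR R * measurableTypeR R)%type.
Implicit Types A B K : set (R * R).

Definition weight (m : nat) (z : R * R) : R :=
  `|z.2| ^+ m * expR (- (z.1 ^+ 2 + z.2 ^+ 2) / 2).

Definition nu (m : nat) (A : set (R * R)) : \bar R :=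
  (\int[@leb2 R]_(z in A) (weight m z)%:E)%E.

Lemma weight_ge0 m z : 0 <= weight m z.
Proof. by rewrite mulr_ge0 ?exprn_ge0 ?expR_ge0. Qed.

Lemma measurable_weight m : measurable_fun [set: plane] (EFin \o weight m).
Proof.
have m2 : measurable_fun [set: plane] (fun z => `|z.2| : line).
  exact: (measurableT_comp (@normr_measurable R setT) measurable_snd).
have mq : measurable_fun [set: plane] (fun z => z.1 ^+ 2 + z.2 ^+ 2 : line).
  by apply: measurable_funD; apply: measurable_funX;
    [exact: measurable_fst|exact: measurable_snd].
apply/measurable_EFinP; apply: measurable_funM; first exact: measurable_funX.
apply: (measurableT_comp (@measurable_expR R)).
by apply: measurable_funM; [exact: measurable_funN|exact: measurable_cst].
Qed.

Lemma nu_ge0 m A : (0 <= nu m A)%E.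
Proof. by apply: integral_ge0 => z _; rewrite lee_fin weight_ge0. Qed.

Lemma nu_le m A B : measurable (A : set plane) -> measurable (B : set plane) ->
  A `<=` B -> (nu m A <= nu m B)%E.
Proof.
move=> mA mB AB; apply: ge0_subset_integral => //.
  exact: (measurable_funTS (measurable_weight m)).
by move=> z _; rewrite lee_fin weight_ge0.
Qed.

Lemma nu_le_leb2 m A B (M : R) : measurable (A : set plane) ->
  measurable (B : set plane) -> A `<=` B -> 0 <= M ->
  (forall z, A z -> weight m z <= M) -> (nu m A <= M%:E * leb2 B)%E.
Proof.
move=> mA mB AB M0 wM; apply: (@le_trans _ _ (M%:E * leb2 A)%E).
  rewrite -integral_cst//; apply: ge0_le_integral => //.
  - by move=> z _; rewrite lee_fin weight_ge0.
  - exact: (measurable_funTS (measurable_weight m)).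
have AB' : (leb2 A <= leb2 B)%E by rewrite /leb2 le_measure ?inE.
have M0' : (0 <= M%:E)%E by rewrite lee_fin.
exact: (lee_wpmul2l M0' AB').
Qed.

Lemma nu_ge_leb2 m A B (c : R) : measurable (A : set plane) ->
  measurable (B : set plane) -> B `<=` A -> 0 <= c ->
  (forall z, B z -> c <= weight m z) -> (c%:E * leb2 B <= nu m A)%E.
Proof.
move=> mA mB BA c0 wc; apply: le_trans (nu_le m mB mA BA).
rewrite -integral_cst//; apply: ge0_le_integral => //.
exact: (measurable_funTS (measurable_weight m)).
Qed.

Definition rectangle (a b c d : R) : set (R * R) :=
  (`[a, b]%classic : set line) `*` (`[c, d]%classic : set line).

Lemma measurable_rectangle a b c d : measurable (rectangle a b c d : set plane).
Proof. by apply: measurableX; exact: measurable_itv. Qed.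

Lemma leb2_rectangle a b c d : a <= b -> c <= d ->
  leb2 (rectangle a b c d) = ((b - a) * (d - c))%:E.
Proof.
have len (x y : R) : x <= y -> @lebesgue_measure R `[x, y]%classic = (y - x)%:E.
  move=> xy; rewrite lebesgue_measure_itv/= lte_fin.
  case: ifPn => [_|]; first by rewrite -EFinD.
  by rewrite -leNgt => yx; rewrite (_ : y = x) ?subrr//; apply: le_anti; rewrite yx xy.
move=> ab cd; rewrite EFinM -!len// /leb2 product_measure1E//; exact: measurable_itv.
Qed.

Lemma mu2E n A : measurable (A : set plane) -> 0 <= Cn R n ->
  mu2 n A = ((Cn R n)%:E * nu n.-1 A)%E.
Proof.
move=> mA C0; rewrite /mu2 /nu -ge0_integralZl//.
- by apply: eq_integral => z _; rewrite -EFinM /dens2 /weight mulrA.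
- exact: (measurable_funTS (measurable_weight n.-1)).
- by move=> z _; rewrite lee_fin weight_ge0.
Qed.

Lemma Cn_ge0 n : 0 <= Cn R n.
Proof.
rewrite /Cn invr_ge0 fine_ge0//; apply: integral_ge0 => t.
rewrite /= in_itv/= => tpi; rewrite lee_fin exprn_ge0//.
exact: cos_ge0_pihalf.
Qed.

Lemma fine_mu2 n A : measurable (A : set plane) ->
  fine (mu2 n A) = Cn R n * fine (nu n.-1 A).
Proof.
move=> mA; rewrite mu2E ?Cn_ge0//; move: (nu_ge0 n.-1 A) (Cn_ge0 n).
case: (nu n.-1 A) => [r _ _|_|//]; first by [].
rewrite le_eqVlt => /orP[/eqP <-|C0]; first by rewrite mul0e mul0r.
by rewrite mulr0 gt0_muley ?lte_fin.
Qed.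

Lemma ratio2E n A B : measurable (A : set plane) -> measurable (B : set plane) ->
  ratio2 n A B = (Cn R n)^-1 *
    (fine (nu n.-1 (A `&` B)) / (fine (nu n.-1 A) * fine (nu n.-1 B))).
Proof.
move=> mA mB; rewrite /ratio2 !fine_mu2//; last exact: measurableI.
(* With a zero constant both sides are 0, the inverse of 0 being 0. *)
have [->|C0] := eqVneq (Cn R n) 0; first by rewrite !mul0r invr0 mul0r.
rewrite !invfM; set x := fine (nu _ (A `&` B)).
set y := (fine (nu _ A))^-1; set z := (fine (nu _ B))^-1.
have kk' := divff C0; set k := Cn R n in kk' *; set k' := k^-1 in kk' *.
by transitivity (k * k' * (k' * (x * (y * z)))); [ring|rewrite kk' mul1r].
Qed.

(** [z] is the midpoint of [- z0] and [z0 + 2 z], and the latter stays in a ball around the interior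
    point [z0]. *)
Lemma symmetric_body_square K : convex_body2 K -> centrally_symmetric2 K ->
  exists2 e, 0 < e & forall z, `|z.1| <= e -> `|z.2| <= e -> K z.
Proof.
move=> [_ [cK [z0 /nbhs_ballP[d /= d0 ball_sub]]]] sK.
have d4 : 0 < d / 4 by rewrite divr_gt0.
exists (d / 4) => // z z1 z2.
have K1 : K (z0.1 + 2 * z.1, z0.2 + 2 * z.2).
  have two (x y : R) : `|y| <= d / 4 -> ball x d (x + 2 * y).
    move=> yd; rewrite /ball/= opprD addrA subrr add0r normrN normrM.
    by rewrite (ger0_norm (ler0n _ 2)); lra.
  by apply: ball_sub; split => /=; exact: two.
have K0 : K z0 by apply: ball_sub; exact: ballxx.
have half : 0 <= (2^-1 : R) <= 1 by lra.
have := cK _ _ K1 (sK _ K0) _ half; rewrite /=.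
rewrite (_ : (_, _) = z)//.
by rewrite [RHS]surjective_pairing; congr (_, _);
  move: z0 z {K1 K0 z1 z2 ball_sub} => [a b] [u v] /=;
  set x1 : R := a; set x2 : R := b; set y1 : R := u; set y2 : R := v; field.
Qed.

End WeightedMeasure.

(** * Positivity for bodies, and strips of small ratio *)

Section StripRatios.
Context {R : realType}.
Notation line := (measurableTypeR R).
Notation plane := (measurableTypeR R * measurableTypeR R)%type.
Notation gauss1 := (@gauss1 R).
Notation gauss2 := (@gauss2 R).
Notation g2 := (prob gauss2).
Implicit Types A B K : set (R * R).

Lemma nu_fin m A : compact A -> measurable (A : set plane) -> (nu m A < +oo)%E.
Proof.
move=> cA mA; have [M MP] := compact2_bounded cA.
have M0 : 0 <= `|M| by [].
have AM z : A z -> `|z.1| <= `|M| /\ `|z.2| <= `|M|.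
  by move=> /MP[z1 z2]; rewrite !(le_trans _ (ler_norm M)).
have mB := @measurable_rectangle R (- `|M|) `|M| (- `|M|) `|M|.
apply: (@le_lt_trans _ _ ((`|M| ^+ m)%:E * leb2 (rectangle (- `|M|) `|M| (- `|M|) `|M|))%E).
  apply: nu_le_leb2 => //; rewrite ?exprn_ge0//.
    by move=> z /AM[z1 z2]; split; rewrite /= in_itv/= -ler_norml.
  move=> z /AM[z1 z2]; rewrite /weight -[leRHS]mulr1; apply: ler_pM.
  - exact: exprn_ge0.
  - exact: expR_ge0.
  - by rewrite lerXn2r// nnegrE.
  - by rewrite -expR0 ler_expR mulNr oppr_le0 divr_ge0// addr_ge0 ?sqr_ge0.
by rewrite leb2_rectangle ?ge0_cp// -EFinM ltry.
Qed.

Lemma nu_gt0 m A (e : R) : measurable (A : set plane) -> 0 < e ->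
  (forall z, `|z.1| <= e -> `|z.2| <= e -> A z) -> (0 < nu m A)%E.
Proof.
(* The rectangle keeps away from [y = 0], where the weight vanishes for [m > 0]. *)
move=> mA e0 eA; have mB := @measurable_rectangle R 0 e (e / 2) e.
pose c := (e / 2) ^+ m * expR (- (e ^+ 2 + e ^+ 2) / 2).
have e20 : 0 < e / 2 by rewrite divr_gt0.
have c0 : 0 < c by rewrite mulr_gt0 ?exprn_gt0 ?expR_gt0.
apply: (@lt_le_trans _ _ (c%:E * leb2 (rectangle 0 e (e / 2) e))%E).
  rewrite leb2_rectangle ?ltW//; last by lra.
  by rewrite -EFinM lte_fin mulr_gt0// mulr_gt0; lra.
apply: nu_ge_leb2 => //; rewrite ?ltW//.
  move=> z [] /=; rewrite !in_itv/= => z1 z2.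
  by apply: eA; rewrite ger0_norm; lra.
move=> z [] /=; rewrite !in_itv/= => /andP[z1 z1e] /andP[z2 z2e].
have z20 : 0 <= z.2 by lra.
rewrite /weight (ger0_norm z20); apply: ler_pM.
- by rewrite exprn_ge0// ltW.
- exact: expR_ge0.
- by rewrite lerXn2r// nnegrE ltW.
rewrite ler_expR !mulNr lerN2 ler_pM2r//.
by apply: lerD; rewrite lerXn2r// nnegrE ltW.
Qed.

Lemma nu_ratio_gt0 m K K' : convex_body2 K -> centrally_symmetric2 K ->
  convex_body2 K' -> centrally_symmetric2 K' ->
  [/\ 0 < fine (nu m (K `&` K')), 0 < fine (nu m K) & 0 < fine (nu m K')].
Proof.
move=> bK sK bK' sK'.
have [e e0 eK] := symmetric_body_square bK sK.
have [e' e'0 eK'] := symmetric_body_square bK' sK'.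
have [cK [vK _]] := bK; have [cK' [vK' _]] := bK'.
have mK := measurable_symmetric_body cK vK sK.
have mK' := measurable_symmetric_body cK' vK' sK'.
have mI : measurable (K `&` K' : set plane) by exact: measurableI.
have finK := nu_fin m cK mK; have finK' := nu_fin m cK' mK'.
have e''0 : 0 < Num.min e e' by rewrite lt_min e0.
split; rewrite fine_gt0//.
- rewrite (nu_gt0 m mI e''0) /=; last first.
    move=> z; rewrite !le_min => /andP[z1 z1'] /andP[z2 z2'].
    by split; [exact: eK|exact: eK'].
  by apply: le_lt_trans finK; apply: nu_le => // z [].
- by rewrite finK (nu_gt0 m mK e0).
- by rewrite finK' (nu_gt0 m mK' e'0).
Qed.

Definition open_strip (a b h : R) : set (R * R) := [set z | `|z.1 * a + z.2 * b| < h].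

Lemma is_strip_open_strip a b h : a ^+ 2 + b ^+ 2 = 1 -> 0 < h ->
  is_strip (open_strip a b h).
Proof. by move=> ab h0; exists (a, b), h. Qed.

Lemma measurable_open_strip a b h : measurable (open_strip a b h : set plane).
Proof.
rewrite (_ : open_strip a b h = (fun z : plane => a * z.1 + b * z.2 : line) @^-1`
   `]- h, h[%classic).
  exact: (measurable_preimageT (measurable_linear a b)).
by apply/funext => z; apply/propext; rewrite /open_strip/= in_itv/= -ltr_norml
  [z.1 * _]mulrC [z.2 * _]mulrC.
Qed.

(* The density vanishes on the line y = 0, so two transversal strips of width h
   have an intersection of mass O(h^3), each of them having mass of order h. *)
Lemma thin_strips_ratio m (r : R) : (0 < m)%N -> 0 < r ->
  exists S S' : set (R * R), [/\ is_strip S, is_strip S',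
    measurable (S : set plane), measurable (S' : set plane) &
    fine (nu m (S `&` S')) / (fine (nu m S) * fine (nu m S')) <= r].
Proof.
move=> m0 r0; pose c : R := expR (- (5 ^+ 2 + 2 ^+ 2) / 2).
have c0 : 0 < c := expR_gt0 _.
(* The second bound is what [16 h ^+ 3 <= r * (c h) ^+ 2] asks for: intersection on the left, the
   two strips on the right. *)
pose h := Num.min 2^-1 (c ^+ 2 * r / 16).
have h0 : 0 < h by rewrite lt_min invr_gt0 ltr0n/= divr_gt0// mulr_gt0// exprn_gt0.
have h12 : h <= 2^-1 by rewrite ge_min lexx.
have hr : h <= c ^+ 2 * r / 16 by rewrite ge_min lexx orbT.
pose S := open_strip 1 0 h; pose S' := open_strip (3 / 5) (4 / 5) h.
have mS : measurable (S : set plane) by exact: measurable_open_strip.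
have mS' : measurable (S' : set plane) by exact: measurable_open_strip.
have wc z : `|z.1| <= 5 -> 1 <= z.2 -> z.2 <= 2 -> c <= weight m z.
  move=> z1 z2 z2'; have z20 : 0 <= z.2 by lra.
  rewrite /weight (ger0_norm z20) -[c]mul1r; apply: ler_pM.
  - exact: ler01.
  - exact: expR_ge0.
  - exact: exprn_ege1.
  rewrite ler_expR !mulNr lerN2 ler_pM2r//; apply: lerD.
    by rewrite -(real_normK (num_real z.1)) lerXn2r// nnegrE.
  by rewrite lerXn2r// nnegrE.
pose B := rectangle (- (h / 2)) (h / 2) 1 2.
have mB : measurable (B : set plane) by exact: measurable_rectangle.
have lB : leb2 B = h%:E.
  by rewrite leb2_rectangle; [congr (_%:E); field|lra|lra].
have nS : ((c * h)%:E <= nu m S)%E.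
  rewrite EFinM -lB; apply: nu_ge_leb2 => //; rewrite ?ltW//.
    move=> z [] /=; rewrite !in_itv/= => z1 _; rewrite /S /open_strip/=.
    by rewrite mulr1 mulr0 addr0 ltr_norml; lra.
  move=> z [] /=; rewrite !in_itv/= => z1 /andP[z2 z2']; apply: wc => //.
  by rewrite ler_norml; lra.
have nS' : ((c * h)%:E <= nu m S')%E.
  (* The form of [S'] is 3/5 of [x + 4/3 y], so a shear carries [B] to a set of the same area inside
     [S']. On it [|x| <= h / 2 + 8/3], below the 5 used in [c]. *)
  have mB' := measurable_preimageT (measurable_linear2 1 (4 / 3) 0 1) mB.
  rewrite EFinM -lB -(leb2_shear1 (4 / 3) mB); apply: nu_ge_leb2 => //.
  - move=> [x y] [] /=; rewrite !in_itv/= => z1 z2; rewrite /S' /open_strip/=.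
    by rewrite ltr_norml; set x1 : R := x in z1 z2 *; set y1 : R := y in z1 z2 *; lra.
  - exact: ltW.
  - move=> [x y] [] /=; rewrite !in_itv/= => z1 z2.
    by apply: wc => /=; rewrite ?ler_norml;
      set x1 : R := x in z1 z2 *; set y1 : R := y in z1 z2 *; lra.
(* On the intersection [4/5 |y| <= h + 3/5 h], so [|y| <= 2 h]. As [m > 0] and [2 h <= 1], the
   weight is at most [2 h], on a rectangle of area [8 h ^+ 2]. *)
have nI : (nu m (S `&` S') <= (16 * h ^+ 3)%:E)%E.
  have -> : (16 * h ^+ 3)%:E = ((2 * h)%:E * leb2 (rectangle (- h) h (- (2 * h)) (2 * h)))%E.
    by rewrite leb2_rectangle; [rewrite -EFinM; congr (_%:E); ring|lra|lra].
  have sub z : (S `&` S') z -> -h <= z.1 <= h /\ - (2 * h) <= z.2 <= 2 * h.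
    move=> []; rewrite /S /S' /open_strip/= !ltr_norml.
    by move: (z.1) (z.2) => /= x y; set x1 : R := x; set y1 : R := y; lra.
  apply: nu_le_leb2.
  - exact: measurableI.
  - exact: measurable_rectangle.
  - by move=> z /sub[z1 z2]; split; rewrite /= in_itv.
  - by lra.
  - move=> z /sub[_ z2]; rewrite /weight -[leRHS]mulr1; apply: ler_pM.
    + exact: exprn_ge0.
    + exact: expR_ge0.
    + have zh : `|z.2| <= 2 * h by rewrite ler_norml.
      rewrite -(prednK m0) exprS -[leRHS]mulr1; apply: ler_pM => //.
      by rewrite exprn_ile1//; lra.
    + by rewrite -expR0 ler_expR mulNr oppr_le0 divr_ge0// addr_ge0 ?sqr_ge0.
exists S, S'; split => //.
- by apply: is_strip_open_strip => //; ring.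
- by apply: is_strip_open_strip => //; field.
(* An infinite mass would have [fine] value 0 and make the quotient 0. *)
have [fS|fS] := boolP (nu m S \is a fin_num); last first.
  by move: fS; rewrite ge0_fin_numE ?nu_ge0// ltey negbK => /eqP ->;
    rewrite mul0r invr0 mulr0 ltW.
have [fS'|fS'] := boolP (nu m S' \is a fin_num); last first.
  by move: fS'; rewrite ge0_fin_numE ?nu_ge0// ltey negbK => /eqP ->;
    rewrite mulr0 invr0 mulr0 ltW.
have fI : fine (nu m (S `&` S')) <= 16 * h ^+ 3.
  by rewrite -lee_fin fineK// ge0_fin_numE ?nu_ge0// (le_lt_trans nI)// ltry.
move: nS nS'; rewrite -(fineK fS) -(fineK fS') !lee_fin /= => nS nS'.
have ch0 : 0 < c * h by rewrite mulr_gt0.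
have SS : 0 < fine (nu m S) * fine (nu m S').
  by rewrite mulr_gt0// (lt_le_trans ch0).
rewrite ler_pdivrMr//; apply: (le_trans fI).
apply: (@le_trans _ _ (r * (c * h * (c * h)))); last first.
  by rewrite ler_wpM2l ?(ltW r0)//; apply: ler_pM => //; exact: ltW.
rewrite (_ : 16 * h ^+ 3 = h ^+ 2 * (16 * h)); last by ring.
rewrite (_ : r * _ = h ^+ 2 * (16 * (c ^+ 2 * r / 16))); last by field.
by rewrite ler_wpM2l ?sqr_ge0// ler_wpM2l.
Qed.

Lemma nu0_gauss2 A : measurable (A : set plane) ->
  fine (nu 0 A) = pi *+ 2 * g2 A.
Proof.
move=> mA; have p0 : 0 < pi *+ 2 :> R by rewrite mulrn_wgt0// pi_gt0.
have -> : nu 0 A = ((pi *+ 2)%:E * gauss2 A)%E.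
  rewrite gauss2E// -ge0_integralZl//.
  - apply: eq_integral => z _; rewrite -EFinM gpdf2E /weight expr0 mul1r.
    by rewrite mulrA divff ?mul1r// gt_eqF.
  - exact: (measurable_funTS measurable_gpdf2).
  - by move=> z _; rewrite lee_fin mulr_ge0 ?gpdf_ge0.
  - by rewrite lee_fin ltW.
by rewrite (probE gauss2 mA).
Qed.

Lemma g2_orthogonal_strips :
  g2 (open_strip 1 0 1 `&` open_strip 0 1 1) =
  g2 (open_strip 1 0 1) * g2 (open_strip 0 1 1).
Proof.
pose I : set line := `]-1, 1[%classic.
have mI : measurable I by exact: measurable_itv.
have E1 : open_strip 1 0 1 = I `*` [set: line].
  apply/seteqP; split => z; rewrite /open_strip /I/= mulr1 mulr0 addr0 in_itv/= ltr_norml//.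
  by case.
have E2 : open_strip 0 1 1 = [set: line] `*` I.
  apply/seteqP; split => z; rewrite /open_strip /I/= mulr1 mulr0 add0r in_itv/= ltr_norml//.
  by case.
have E12 : open_strip 1 0 1 `&` open_strip 0 1 1 = I `*` I.
  by rewrite E1 E2 -setXI setIT setTI.
have m1 := measurable_open_strip 1 0 1; have m2 := measurable_open_strip 0 1 1.
have m12 := measurableI _ _ m1 m2.
have P1 : gauss2 (open_strip 1 0 1) = gauss1 I.
  rewrite E1; apply: (etrans (product_measure1E gauss1 gauss1 mI measurableT)).
  by rewrite [X in (_ * X)%E](probability_setT gauss1) mule1.
have P2 : gauss2 (open_strip 0 1 1) = gauss1 I.
  rewrite E2; apply: (etrans (product_measure1E gauss1 gauss1 measurableT mI)).
  by rewrite [X in (X * _)%E](probability_setT gauss1) mul1e.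
have P12 : gauss2 (open_strip 1 0 1 `&` open_strip 0 1 1) = (gauss1 I * gauss1 I)%E.
  by rewrite E12; exact: (product_measure1E gauss1 gauss1 mI mI).
apply: EFin_inj; rewrite EFinM.
move: P12; rewrite -{1}P1 -P2 (probE _ m12) (probE _ m1) (probE _ m2) => ->//.
Qed.

End StripRatios.

Theorem theorem2 (R : realType) (n : nat) (K1 K2 : set (R * R)) :
  (1 <= n)%N ->
  convex_body2 K1 -> centrally_symmetric2 K1 ->
  convex_body2 K2 -> centrally_symmetric2 K2 ->
  exists S1 S2 : set (R * R), is_strip S1 /\ is_strip S2 /\
    ratio2 n S1 S2 <= ratio2 n K1 K2.
Proof.
move=> n1 bK1 sK1 bK2 sK2; have [c1 [v1 _]] := bK1; have [c2 [v2 _]] := bK2.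
have m1 := measurable_symmetric_body c1 v1 sK1.
have m2 := measurable_symmetric_body c2 v2 sK2.
have [pI p1 p2] := nu_ratio_gt0 n.-1 bK1 sK1 bK2 sK2.
have C0 : 0 <= (Cn R n)^-1 by rewrite invr_ge0 Cn_ge0.
rewrite (ratio2E n m1 m2).
case: n n1 pI p1 p2 C0 => [//|[|m]] _ /= pI p1 p2 C0; last first.
  have r0 := divr_gt0 pI (mulr_gt0 p1 p2).
  have [S [S' [sS sS' mS mS' le]]] := thin_strips_ratio (ltn0Sn m) r0.
  exists S, S'; split=> //; split=> //.
  by rewrite (ratio2E _ mS mS') ler_wpM2l.
have mS1 := @measurable_open_strip R 1 0 1.
have mS2 := @measurable_open_strip R 0 1 1.
exists (open_strip 1 0 1), (open_strip 0 1 1).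
split; first by apply: is_strip_open_strip; rewrite ?ltr01//; ring.
split; first by apply: is_strip_open_strip; rewrite ?ltr01//; ring.
rewrite (ratio2E _ mS1 mS2) ler_wpM2l//=.
have p0 : 0 < pi *+ 2 :> R by rewrite mulrn_wgt0// pi_gt0.
have mI := measurableI _ _ m1 m2; have mSI := measurableI _ _ mS1 mS2.
move: pI p1 p2; rewrite !nu0_gauss2// !pmulr_rgt0// => pI p1 p2.
have K1n : K1 !=set0 by apply/set0P/eqP => K10; move: p1; rewrite K10 prob_set0 ltxx.
have K2n : K2 !=set0 by apply/set0P/eqP => K20; move: p2; rewrite K20 prob_set0 ltxx.
have gci := gaussian_correlation c1 v1 sK1 K1n c2 v2 sK2 K2n.
(* As [nu 0] is [pi *+ 2] times a probability, independence gives exactly this ratio when the strips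
   have positive mass, and positive correlation gives at least it for the bodies. *)
apply: (@le_trans _ _ (pi *+ 2)^-1).
  rewrite g2_orthogonal_strips; set x := prob _ _; set y := prob _ _.
  have [xy0|xy0] := eqVneq (x * y) 0.
    by rewrite xy0 mulr0 mul0r invr_ge0 ltW.
  rewrite mulrACA invfM mulrACA mulfV// mulr1 invfM mulrA mulfV ?mul1r// gt_eqF//.
rewrite ler_pdivlMr ?mulr_gt0// mulrACA.
rewrite -[X in _ * X]mulrA mulKf ?gt_eqF//.
by rewrite ler_pM2l.
Qed.
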